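(* Let $\lambda\ge 4.67$ be fixed. There exists $f(\lambda)>0$ such that for the Erdős–Rényi random graph $G_n\in\mathrm{ER}(n,\lambda/n)$ with giant component $\mathscr{C}_{\max}$, with high probability (i.e. with probability tending to $1$ as $n\to\infty$), $$\mathbb{E}(\zeta_{slim}(\mathscr{C}_{\max}))\ \ge\ f(\lambda)\log n\quad\text{and}\quad \mathbb{E}(\eta_{minsize}(\mathscr{C}_{\max}))\ \ge\ f(\lambda)\log n .$$
   Context: $\mathrm{ER}(n,p)$ is the random graph on $n$ labelled vertices in which each pair of vertices is joined by an edge independently with probability $p$. The giant component $\mathscr{C}_{\max}$ is the largest connected component. Let $G$ be a finite connected graph with shortest-path metric. A geodesic triangle $\Delta(x,y,z)$ is a choice of shortest paths $[x,y],[y,z],[z,x]$ (regarded as vertex sets). $\mathrm{slim}(\Delta(x,y,z))$ is the smallest $\delta\ge0$ such that every vertex on one side is at distance at most $\delta$ from the union of the other two sides (for each of the three sides). $\mathrm{minsize}(\Delta(x,y,z))=\min\mathrm{diam}\{x',y',z'\}$ over vertices $x'\in[y,z]$, $y'\in[z,x]$, $z'\in[x,y]$. A random triangle on $x,y,z$ is obtained by choosing each side independently and uniformly among all shortest paths between its endpoints. $\mathbb{E}(\zeta_{slim}(G))$ (resp. $\mathbb{E}(\eta_{minsize}(G))$) is the expectation of $\mathrm{slim}(\Delta(x,y,z))$ (resp. $\mathrm{minsize}(\Delta(x,y,z))$) over $x,y,z$ i.i.d. uniform vertices of $G$ and the random triangle; for random $G$ these are random variables depending on $G$. *)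

(* Defs.v *)
From mathcomp Require Import all_boot all_order all_algebra.
Set Implicit Arguments.
Unset Strict Implicit.
Unset Printing Implicit Defensive.
Import Order.TTheory GRing.Theory Num.Theory.
Local Open Scope ring_scope.

Section Metric.
Variables (T : finType) (e : rel T).

(* Least k < #|T| satisfying P, and #|T| if there is none.  In a connected
   graph all distances are < #|T|, so the cut-off never matters below. *)
Definition least (P : pred nat) : nat := find P (iota 0 #|T|).

(* Walks from x to y of length k, each encoded by its k vertices after x. *)
Definition walks (x y : T) (k : nat) : {set k.-tuple T} :=
  [set p : k.-tuple T | path e x p && (last x p == y)].

Definition dist (x y : T) : nat := least (fun k => walks x y k != set0).

Definition geodesics (x y : T) : {set (dist x y).-tuple T} :=
  walks x y (dist x y).

Definition vertices (x : T) (p : seq T) : {set T} := [set v in x :: p].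

Definition diam (A : {set T}) : nat :=
  (\max_(u in A) \max_(v in A) dist u v)%N.

Definition near_set (A : {set T}) (d : nat) (u : T) : bool :=
  [exists v in A, (dist u v <= d)%N].

(* A triangle is given by the vertex sets of its sides: Sxy for [x, y], etc.
   As distances are integers, the smallest real d >= 0 is a natural number. *)
Definition slim (Sxy Syz Szx : {set T}) : nat :=
  least (fun d => [&& [forall u in Sxy, near_set (Syz :|: Szx) d u],
                      [forall u in Syz, near_set (Szx :|: Sxy) d u] &
                      [forall u in Szx, near_set (Sxy :|: Syz) d u]]).

Definition minsize (Sxy Syz Szx : {set T}) : nat :=
  least (fun d => [exists x' in Syz, exists y' in Szx, exists z' in Sxy,
                     diam [set x'; y'; z'] == d]).

End Metric.

(* Expectation of F u for u uniform in A. *)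
Definition average (R : realFieldType) (U : finType) (A : {set U})
    (F : U -> R) : R :=
  (\sum_(u in A) F u) / #|A|%:R.

(* By independence, the expectation over the random vertices and sides is an
   iterated average. *)
Definition triangle_expectation (R : realFieldType) (T : finType) (e : rel T)
    (F : {set T} -> {set T} -> {set T} -> nat) : R :=
  average [set: T] (fun x => average [set: T] (fun y => average [set: T] (fun z =>
    average (geodesics e x y) (fun p =>
    average (geodesics e y z) (fun q =>
    average (geodesics e z x) (fun r =>
      (F (vertices x p) (vertices y q) (vertices z r))%:R)))))).

Definition mean_slim (R : realFieldType) (T : finType) (e : rel T) : R :=
  triangle_expectation R e (slim e).

Definition mean_minsize (R : realFieldType) (T : finType) (e : rel T) : R :=
  triangle_expectation R e (minsize e).

Section Components.
Variables (T : finType) (e : rel T).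

Definition components : {set {set T}} :=
  [set [set y | connect e x y] | x : T].

Definition is_largest_component (C : {set T}) : bool :=
  (C \in components) && [forall D in components, (#|D| <= #|C|)%N].

Definition induced_subgraph (C : {set T}) : rel {x : T | x \in C} :=
  relpre val e.

End Components.

Arguments induced_subgraph {T} e C.

(* A graph on n labelled vertices is its edge set, a set of pairs. *)
Definition vertex_pairs (n : nat) : {set {set 'I_n}} :=
  [set s : {set 'I_n} | #|s| == 2%N].

Definition adj (n : nat) (E : {set {set 'I_n}}) : rel 'I_n :=
  [rel x y | (x != y) && ([set x; y] \in E)].

(* Probability of the event A in ER(n, p).  This is a probability only for
   0 <= p <= 1, which holds for p = lambda / n as soon as n >= lambda. *)
Definition ER_prob (R : realFieldType) (n : nat) (p : R)
    (A : pred {set {set 'I_n}}) : R :=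
  \sum_(E in powerset (vertex_pairs n) | A E)
     \prod_(s in vertex_pairs n) (if s \in E then p else 1 - p).

(* Main.v *)
(* Let N = log n / log lambda. If a geodesic triangle x, y, z with sides of
   length at most (7/6) N has three points, one per side, within eps N of each
   other, then some vertex w satisfies
   d(w, x) + d(w, y) + d(w, z) <= (7/4 + 2 eps) N, and by a first moment bound
   there are only n^(11/4 + 2 eps + o(1)) such triples. The same bound handles
   slim, since a triangle with small slim also has small minsize (walk along one
   side).

   It remains to find, with high probability, a positive proportion of triples
   of the largest component whose pairwise distances are at most L = (7/6) N.
   The size of the sphere of radius L/2 around a vertex has second moment close
   to lambda / (lambda - 1) times its squared mean, so it is large with
   probability close to at least 1 - 1/lambda, which exceeds 3/4 as soon as
   lambda > 4; two large spheres are joined by an edge. Hence d(x, y) <= L for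
   more than half of the pairs in expectation. The Efron-Stein inequality
   concentrates the number of such pairs: an edge uv matters only to the pairs
   x, y joined by a path of length at most L through uv, about lambda^L of them.
   Finally a graph with more than n^2/4 edges has a positive density of
   triangles, and vertices outside the largest component do not contribute to
   the count because their degree is at most n/2. *)
Require Import Defs.
From mathcomp Require Import all_boot all_order all_algebra.
From mathcomp Require Import ring lra zify.
Set Implicit Arguments.
Unset Strict Implicit.
Unset Printing Implicit Defensive.
Import Order.TTheory GRing.Theory Num.Theory.
Local Open Scope ring_scope.

(** * Expectation over a random subset *)

Section RandomSubset.
Variables (R : realFieldType) (T : finType) (p : R).
Hypotheses (p_ge0 : 0 <= p) (p_le1 : p <= 1).
Implicit Types (F G : {set T} -> R) (l : seq T).

(** The elements of [l] are exposed one at a time, each kept with probability [p], so that moment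
    identities become inductions on [l]. *)
Fixpoint expect l F : R :=
  if l is e :: l' then
    p * expect l' (fun E => F (e |: E)) + (1 - p) * expect l' F
  else F set0.

Lemma expect_powerset l F : uniq l ->
  expect l F = \sum_(E in powerset [set e in l])
    (\prod_(e in [set e in l]) (if e \in E then p else 1 - p)) * F E.
Proof.
elim: l F => [|e l IH] F /=.
  move=> _; have -> : [set e in [::]] = set0 :> {set T} by apply/setP=> x; rewrite !inE.
  by rewrite powerset0 big_set1 big_set0 mul1r.
case/andP=> enl ul; rewrite !IH // !mulr_sumr.
have -> : [set e0 in e :: l] = e |: [set e in l].
  by apply/setP=> x; rewrite !inE.
set D := [set e in l]; have eD : e \notin D by rewrite inE.
rewrite [RHS](bigID (fun E : {set T} => e \in E)) /=; congr (_ + _).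
  rewrite [RHS](reindex_onto (fun E : {set T} => e |: E) (fun E => E :\ e)) /=; last first.
    by move=> E /andP[_ eE]; rewrite setD1K.
  apply: eq_big => [E|E].
    rewrite !powersetE setU11 andbT; apply/idP/idP.
      move=> ED; have eE : e \notin E by apply: contra eD; apply: subsetP.
      by rewrite setU1K // eqxx setUS.
    case/andP=> ED /eqP <-; rewrite subDset; exact: ED.
  rewrite powersetE => ED; rewrite big_setU1 //= setU11 mulrA; congr (_ * _ * _).
  apply: eq_bigr => x xD; rewrite !inE; case: eqP => // xe.
  by rewrite -xe xD in eD.
apply: eq_big => [E|E].
  rewrite !powersetE; apply/idP/idP.
    move=> ED; rewrite (contra _ eD) ?andbT; last exact: (subsetP ED).
    by apply: (subset_trans ED); rewrite subsetUr.
  case/andP=> /subsetP ED eE; apply/subsetP=> x xE.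
  move: (ED x xE); rewrite !inE; case/orP=> [/eqP xe|//].
  by rewrite -xe xE in eE.
rewrite powersetE => ED; rewrite big_setU1 //=.
have /negbTE -> : e \notin E by apply: contra eD; apply: subsetP.
by rewrite mulrA.
Qed.

Lemma eq_expect l F G :
  (forall E : {set T}, {subset E <= l} -> F E = G E) -> expect l F = expect l G.
Proof.
elim: l F G => [|e l IH] F G FG /=; first by apply: FG => x; rewrite inE.
congr (_ * _ + _ * _); apply: IH => E El; apply: FG => x.
  by rewrite !inE; case/orP=> [->//|/El ->]; rewrite orbT.
by move=> xE; rewrite inE (El _ xE) orbT.
Qed.

Lemma le_expect l F G : (forall E, F E <= G E) -> expect l F <= expect l G.
Proof.
elim: l F G => [|e l IH] F G FG /=; first exact: FG.
by apply: lerD; apply: ler_wpM2l; rewrite ?subr_ge0 //; apply: IH.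
Qed.

Lemma expect_cst l c : expect l (fun=> c) = c.
Proof. by elim: l => //= e l ->; ring. Qed.

Lemma expectD l F G :
  expect l (fun E => F E + G E) = expect l F + expect l G.
Proof. by elim: l F G => //= e l IH F G; rewrite !IH; ring. Qed.

Lemma expectZ l c F : expect l (fun E => c * F E) = c * expect l F.
Proof. by elim: l F => //= e l IH F; rewrite !IH; ring. Qed.

Lemma expect_sum l (I : Type) (s : seq I) (P : pred I) (F : I -> {set T} -> R) :
  expect l (fun E => \sum_(i <- s | P i) F i E) =
  \sum_(i <- s | P i) expect l (F i).
Proof.
elim: s => [|i s IH].
  by rewrite big_nil -[RHS](expect_cst l); apply: eq_expect => E _; rewrite big_nil.
rewrite big_cons; case Pi : (P i); [rewrite -IH -expectD|rewrite -IH];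
  by apply: eq_expect => E _; rewrite big_cons Pi.
Qed.

Lemma expect_ge0 l F : (forall E, 0 <= F E) -> 0 <= expect l F.
Proof. by move=> F0; rewrite -(expect_cst l 0); apply: le_expect. Qed.

(** Induction on [l]: the element being exposed affects only one of the two factors, and the other
    one comes out of the average over it. *)
Lemma expect_indep l (A : {set T}) F G :
  (forall E : {set T}, F E = F (E :&: A)) -> (forall E : {set T}, G E = G (E :\: A)) ->
  expect l (fun E => F E * G E) = expect l F * expect l G.
Proof.
elim: l F G => [//|e l IH] F G FA GA /=.
have [eA|eA] := boolP (e \in A).
  have Ge E : G (e |: E) = G E.
    rewrite GA [RHS]GA; congr G; apply/setP=> x; rewrite !inE.
    by case: eqP => [->|//]; rewrite eA.
  have E1 : expect l (fun E => F (e |: E) * G (e |: E)) =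
            expect l (fun E => F (e |: E)) * expect l G.
    rewrite -IH //; first by apply: eq_expect => E _; rewrite Ge.
    move=> E; rewrite FA [RHS]FA; congr F; apply/setP=> x; rewrite !inE.
    by case: (x \in A); rewrite ?andbF ?andbT.
  rewrite E1 IH //.
  have -> : expect l (fun E => G (e |: E)) = expect l G.
    by apply: eq_expect => E _; rewrite Ge.
  ring.
have Fe E : F (e |: E) = F E.
  rewrite FA [RHS]FA; congr F; apply/setP=> x; rewrite !inE.
  by case: eqP => [->|//]; rewrite (negbTE eA) !andbF.
have E1 : expect l (fun E => F (e |: E) * G (e |: E)) =
          expect l F * expect l (fun E => G (e |: E)).
  rewrite -IH //; first by apply: eq_expect => E _; rewrite Fe.
  move=> E; rewrite GA [RHS]GA; congr G; apply/setP=> x; rewrite !inE.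
  by case: (x \in A); rewrite ?andbF ?andbT.
rewrite E1 IH //.
have -> : expect l (fun E => F (e |: E)) = expect l F.
  by apply: eq_expect => E _; rewrite Fe.
ring.
Qed.

Lemma card_setU1I (e : T) (E D : {set T}) : e \notin E ->
  #|(e |: E) :&: D| = (#|E :&: D| + (e \in D))%N.
Proof.
move=> eE; rewrite setIUl cardsU addnC.
have -> : [set e] :&: D :&: (E :&: D) = set0.
  apply/setP=> x; rewrite !inE; apply/negbTE; apply/negP.
  by move=> /andP[/andP[/eqP -> _] /andP[xE _]]; rewrite xE in eE.
rewrite cards0 subn0; congr (_ + _)%N.
have -> : [set e] :&: D = if e \in D then [set e] else set0.
  by apply/setP=> x; rewrite !inE; case: ifP => eD; rewrite !inE; case: eqP => // ->.
by case: (e \in D); rewrite ?cards1 ?cards0.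
Qed.

(** The generating function of a binomial variable, used at [t = 1 + c] for exponential moments and
    at [t = 0] for the probability that no pair of [D] is present. *)
Lemma expect_expn l (D : {set T}) t : uniq l ->
  expect l (fun E => t ^+ #|E :&: D|) = (1 - p + p * t) ^+ count (mem D) l.
Proof.
elim: l => [|e l IH] /=; first by rewrite set0I cards0.
case/andP=> el ul.
have -> : expect l (fun E => t ^+ #|(e |: E) :&: D|) =
          expect l (fun E => t ^+ (e \in D) * t ^+ #|E :&: D|).
  apply: eq_expect => E El; rewrite card_setU1I 1?addnC 1?exprD //.
  by apply: contra el; exact: El.
rewrite expectZ IH // exprD.
by case: (e \in D); rewrite ?expr1 ?expr0; ring.
Qed.

Lemma expect_card l (D : {set T}) : uniq l ->
  expect l (fun E => #|E :&: D|%:R) = p * (count (mem D) l)%:R.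
Proof.
elim: l => [|e l IH] /=; first by rewrite set0I cards0 mulr0.
case/andP=> el ul.
have -> : expect l (fun E => #|(e |: E) :&: D|%:R) =
          expect l (fun E => #|E :&: D|%:R + (e \in D)%:R).
  apply: eq_expect => E El; rewrite card_setU1I ?natrD //.
  by apply: contra el; exact: El.
by rewrite expectD expect_cst IH // natrD /=; case: (e \in D); ring.
Qed.

Lemma expect_card2 l (D : {set T}) : uniq l ->
  expect l (fun E => #|E :&: D|%:R ^+ 2) =
  p * (1 - p) * (count (mem D) l)%:R + (p * (count (mem D) l)%:R) ^+ 2.
Proof.
elim: l => [|e l IH] /=; first by move=> _; rewrite set0I cards0; ring.
case/andP=> el ul.
have -> : expect l (fun E => #|(e |: E) :&: D|%:R ^+ 2) =
          expect l (fun E => #|E :&: D|%:R ^+ 2 +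
            ((e \in D)%:R *+ 2 * #|E :&: D|%:R + (e \in D)%:R)).
  apply: eq_expect => E El; rewrite card_setU1I ?natrD //.
    by case: (e \in D); rewrite /= ?expr1n; ring.
  by apply: contra el; exact: El.
rewrite !expectD expectZ expect_cst IH // expect_card // natrD.
by case: (e \in D); rewrite /=; ring.
Qed.

(* Conditioning on the first coordinate splits the variance into the mean
   conditional variance and the variance of the conditional mean; convexity of
   the square bounds the discrete derivatives of the latter. *)
Lemma efron_stein l F : uniq l ->
  expect l (fun E => F E ^+ 2) - expect l F ^+ 2 <=
  \sum_(e <- l) p * expect l (fun E => (F (e |: E) - F (E :\ e)) ^+ 2).
Proof.
elim: l F => [|e l IH] F; first by rewrite big_nil /= subrr.
rewrite cons_uniq => /andP[el ul].
pose Fm E := p * F (e |: E) + (1 - p) * F E.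
have IHm := IH Fm ul.
have eE (E : {set T}) : {subset E <= l} -> e \notin E by move=> El; apply: contra el; exact: El.
have var_split : expect (e :: l) (fun E => F E ^+ 2) - expect (e :: l) F ^+ 2 =
    p * (1 - p) * expect l (fun E => (F (e |: E) - F E) ^+ 2) +
    (expect l (fun E => Fm E ^+ 2) - expect l Fm ^+ 2).
  rewrite /= expectD !expectZ -!expectZ -!expectD addrA -expectD.
  congr (_ - _); apply: eq_expect => E _; rewrite /Fm; ring.
rewrite var_split big_cons; apply: lerD.
  have -> : expect (e :: l) (fun E => (F (e |: E) - F (E :\ e)) ^+ 2) =
            expect l (fun E => (F (e |: E) - F E) ^+ 2).
    rewrite /= -!expectZ -expectD; apply: eq_expect => E El.
    have E1 : E :\ e = E.
      by apply/setP=> x; rewrite !inE; case: eqP => // ->; rewrite (negbTE (eE _ El)).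
    rewrite (setU1K (eE _ El)) E1 setUA setUid; ring.
  rewrite -mulrA ler_wpM2l // ler_piMl ?lerBlDr ?lerDl //.
  by apply: expect_ge0 => E; rewrite sqr_ge0.
apply: (le_trans IHm); rewrite !big_seq; apply: ler_sum => e' e'l.
have ne : e' != e by apply: contra el => /eqP <-.
rewrite ler_wpM2l //= -!expectZ -expectD; apply: le_expect => E.
rewrite /Fm setUCA.
have -> : (e |: E) :\ e' = e |: (E :\ e').
  apply/setP=> x; rewrite !inE; case: eqP => [->|//].
  by rewrite (negbTE ne).
set a1 := F _; set a2 := F _; set b1 := F _; set b2 := F _.
have : 0 <= p * (1 - p) * ((a1 - b1) - (a2 - b2)) ^+ 2.
  by rewrite mulr_ge0 ?sqr_ge0 // mulr_ge0 // subr_ge0.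
by lra.
Qed.

End RandomSubset.

Lemma ER_probE (R : realFieldType) n (p : R) (A : pred {set {set 'I_n}}) :
  ER_prob p A = expect p (enum (vertex_pairs n)) (fun E => (A E)%:R).
Proof.
rewrite /ER_prob expect_powerset ?enum_uniq //.
have -> : [set e in enum (vertex_pairs n)] = vertex_pairs n.
  by apply/setP=> e; rewrite inE mem_enum.
rewrite big_mkcondr /=; apply: eq_bigr => E _.
by case: (A E); rewrite ?mulr1 ?mulr0.
Qed.

(** * Walks and breadth-first exploration *)

Section Reach.
Variables (T : finType) (e : rel T).

(** Walks of length at most [k], without the cut-off built into [dist]. *)
Fixpoint reach (k : nat) (x y : T) : bool :=
  if k is k'.+1 then reach k' x y || [exists u, reach k' x u && e u y]
  else x == y.

Lemma reach_refl k x : reach k x x.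
Proof. by elim: k => //= k ->. Qed.

Lemma reach_leq k k' x y : (k <= k')%N -> reach k x y -> reach k' x y.
Proof.
move=> /subnK <-; elim: (k' - k)%N => //= j IH /IH h.
by rewrite h.
Qed.

Lemma reachSP k x y :
  reflect (reach k x y \/ exists2 u, reach k x u & e u y) (reach k.+1 x y).
Proof.
apply: (iffP orP) => -[h|h]; [by left|right|by left|right].
  by case/existsP: h => u /andP[]; exists u.
by case: h => u xu uy; apply/existsP; exists u; apply/andP.
Qed.

Lemma reach_step k x u y : reach k x u -> e u y -> reach k.+1 x y.
Proof. by move=> xu uy; apply/reachSP; right; exists u. Qed.

Lemma reach_trans i j y x z : reach i x y -> reach j y z -> reach (i + j) x z.
Proof.
move=> xy; elim: j z => [z /eqP <-|j IH z]; first by rewrite addn0.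
rewrite addnS => /reachSP[/IH|[u /IH xu uz]]; first exact: reach_leq.
exact: reach_step uz.
Qed.

Lemma reach_edge x y : e x y -> reach 1 x y.
Proof. by apply: reach_step; exact: reach_refl. Qed.

Lemma reach_sym k x y : symmetric e -> reach k x y = reach k y x.
Proof.
move=> se; suff h a b : reach k a b -> reach k b a by apply/idP/idP; apply: h.
elim: k a b => [a b|k IH a b]; first by rewrite /= eq_sym.
case/reachSP=> [/IH|[u /IH ua ub]]; first exact: reach_leq.
rewrite -add1n; apply: reach_trans ua; apply: reach_edge; by rewrite se.
Qed.

Lemma reach_path x p : path e x p -> reach (size p) x (last x p).
Proof.
elim: p x => [x _|y p IH x /=]; first exact: reach_refl.
case/andP=> xy /IH; exact: reach_trans (reach_edge xy).
Qed.

Lemma reach_pathP k x y : reach k x y ->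
  exists p, [/\ path e x p, last x p = y & (size p <= k)%N].
Proof.
elim: k y => [y /eqP <-|k IH y]; first by exists [::].
case/reachSP=> [/IH[p [pp lp sp]]|[u /IH[p [pp lp sp]] uy]].
  by exists p; split => //; apply: leqW.
by exists (rcons p y); rewrite rcons_path pp lp uy last_rcons size_rcons ltnS.
Qed.

Lemma reach_connect k x y : reach k x y -> connect e x y.
Proof. by case/reach_pathP=> p [pp <- _]; apply/connectP; exists p. Qed.

Lemma walks_path x p : path e x p -> walks e x (last x p) (size p) != set0.
Proof.
move=> pp; apply/set0Pn; exists (in_tuple p).
by rewrite inE /= pp eqxx.
Qed.

Lemma dist_le_reach k x y : reach k x y -> (dist e x y <= k)%N.
Proof.
case/reach_pathP=> p [pp <- sp]; apply: leq_trans sp.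
rewrite /dist /least; set P := fun k => _.
(* For long walks the bound is free, since the default value of [least] is [#|T|]. *)
have [ltpT|leTp] := ltnP (size p) #|T|; last first.
  by rewrite (leq_trans (find_size _ _)) // size_iota.
rewrite leqNgt; apply/negP => /(before_find 0%N).
by rewrite nth_iota // add0n /P walks_path.
Qed.

(** A walk without repeated vertices has fewer than [#|T|] edges, so the search defining [dist]
    succeeds before its cut-off. *)
Lemma connect_dist x y : connect e x y ->
  (dist e x y < #|T|)%N /\ geodesics e x y != set0.
Proof.
case/connectP=> p0 pp0 ->; case: (shortenP pp0) => p pp up _.
have sp : (size p < #|T|)%N.
  by rewrite -ltnS -[(size p).+1]/(size (x :: p)) -(card_uniqP up) ltnS max_card.
set P := fun k => walks e x (last x p) k != set0.
have hP : has P (iota 0 #|T|).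
  by apply/hasP; exists (size p); [rewrite mem_iota | exact: walks_path].
have h := hP; rewrite has_find size_iota in h; split=> //.
by have := nth_find 0%N hP; rewrite nth_iota.
Qed.

Lemma geodesic_path x y (p : (dist e x y).-tuple T) : p \in geodesics e x y ->
  path e x p /\ last x p = y.
Proof. by rewrite inE => /andP[-> /eqP]. Qed.

Lemma reach_dist x y : connect e x y -> reach (dist e x y) x y.
Proof.
case/connect_dist=> _ /set0Pn[p /geodesic_path[pp lp]].
by rewrite -{2}lp -{1}(size_tuple p); apply: reach_path.
Qed.

Lemma geodesic_split x y (p : (dist e x y).-tuple T) v :
  p \in geodesics e x y -> v \in vertices x p ->
  exists i j, [/\ reach i x v, reach j v y & (i + j = dist e x y)%N].
Proof.
case/geodesic_path=> pp lp; rewrite inE => vp.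
have sp := size_tuple p; move: (tval p) pp lp vp sp => q qq lq vq sq.
case/splitPl: vq qq lq sq => p1 p2 l1; rewrite cat_path last_cat l1 size_cat.
case/andP=> q1 q2 l2 sq; exists (size p1), (size p2); split=> //.
  by rewrite -l1 reach_path.
by rewrite -l2 reach_path.
Qed.

End Reach.

Lemma sub_reach (T : finType) (e e' : rel T) k x y :
  subrel e e' -> reach e k x y -> reach e' k x y.
Proof.
move=> ee'; elim: k y => [//|k IH y].
by case/reachSP=> [/IH|[u /IH xu /ee']]; [exact: reach_leq | exact: reach_step].
Qed.

(** * Breadth-first exploration and the pairs it exposes *)

Section Exploration.
Variable n : nat.
Implicit Types (E : {set {set 'I_n}}) (B S : {set 'I_n}) (x y u v : 'I_n).

Lemma adj_sym E : symmetric (adj E).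
Proof. by move=> x y; rewrite /adj /= eq_sym setUC. Qed.

Definition neighbours E S : {set 'I_n} := [set v | [exists u in S, adj E u v]].

Definition explore E (BS : {set 'I_n} * {set 'I_n}) :=
  let N := neighbours E BS.2 :\: BS.1 in (BS.1 :|: N, N).

(* The ball of radius k around x, together with the sphere bounding it. *)
Definition bfs E x k := iter k (explore E) ([set x], [set x]).
Definition ball E x k := (bfs E x k).1.
Definition sphere E x k := (bfs E x k).2.

Lemma bfs_eq E x k : bfs E x k = (ball E x k, sphere E x k).
Proof. by rewrite /ball /sphere -surjective_pairing. Qed.

Lemma ballS E x k : ball E x k.+1 = ball E x k :|: sphere E x k.+1.
Proof. by []. Qed.

Lemma sphereS E x k :
  sphere E x k.+1 = neighbours E (sphere E x k) :\: ball E x k.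
Proof. by []. Qed.

Lemma sphere_ball E x k : sphere E x k \subset ball E x k.
Proof. by case: k => [|k]; rewrite ?ballS ?subsetUr. Qed.

Lemma mem_neighbours E S u v : u \in S -> adj E u v -> v \in neighbours E S.
Proof. by move=> uS uv; rewrite inE; apply/existsP; exists u; rewrite uS. Qed.

(** Expanding the last sphere alone is enough: the neighbours of earlier vertices were added at
    earlier steps. *)
Lemma ball_interior E x k u v :
  u \in ball E x k -> adj E u v -> v \in ball E x k.+1.
Proof.
elim: k => [|k IH] uB uv.
  rewrite ballS sphereS in_setU in_setD orbC.
  by case: (v \in ball E x 0); rewrite //= (mem_neighbours uB uv).
rewrite ballS sphereS in_setU in_setD.
case: (boolP (v \in _)) => //= vB.
have [uS|uS] := boolP (u \in sphere E x k.+1); first exact: mem_neighbours uS uv.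
case/negP: vB; apply: IH uv; move: uB.
by rewrite ballS in_setU (negbTE uS) orbF.
Qed.

Lemma in_ball E x k y : (y \in ball E x k) = reach (adj E) k x y.
Proof.
elim: k y => [y|k IH y]; first by rewrite inE eq_sym.
apply/idP/reachSP => [|[|[u xu uy]]].
- rewrite ballS in_setU IH => /orP[->|]; first by left.
  rewrite sphereS in_setD => /andP[_]; rewrite inE => /existsP[u /andP[uS uy]].
  by right; exists u => //; rewrite -IH (subsetP (sphere_ball _ _ _)).
- by rewrite -IH ballS in_setU => ->.
by apply: ball_interior uy; rewrite IH.
Qed.

Lemma card_ballS E x k : #|ball E x k.+1| = (#|ball E x k| + #|sphere E x k.+1|)%N.
Proof.
rewrite ballS cardsU; have -> : ball E x k :&: sphere E x k.+1 = set0.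
  by apply/setP=> y; rewrite sphereS !inE; case: (y \in ball _ _ _).
by rewrite cards0 subn0.
Qed.

Lemma card_ball E x k : #|ball E x k| = (\sum_(j < k.+1) #|sphere E x j|)%N.
Proof.
elim: k => [|k IH]; first by rewrite big_ord_recl big_ord0 addn0.
by rewrite card_ballS IH [RHS]big_ord_recr.
Qed.

(** The pairs exposed once the vertices of [I] have been expanded. *)
Definition touching (I : {set 'I_n}) : {set {set 'I_n}} :=
  [set d | d :&: I != set0].

Lemma pair_touching (I : {set 'I_n}) u v : u \in I -> [set u; v] \in touching I.
Proof. by move=> uI; rewrite inE; apply/set0Pn; exists u; rewrite !inE eqxx uI. Qed.

Lemma neighbours_eq E E' S :
  E :&: touching S = E' :&: touching S -> neighbours E S = neighbours E' S.
Proof.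
move=> EE'; apply/setP=> v; rewrite !inE; apply: eq_existsb => u /=.
case: (boolP (u \in S)) => //= uS; congr (_ && _).
have := congr1 (fun D : {set {set 'I_n}} => [set u; v] \in D) EE'.
by rewrite !in_setI !pair_touching // !andbT.
Qed.

(* Whether the exploration has reached the state (B, S) can be read off from
   the pairs that touch B :\: S: the pairs leaving S have not been exposed. *)
Lemma bfs_local E E' x k B S :
  E :&: touching (B :\: S) = E' :&: touching (B :\: S) ->
  bfs E x k = (B, S) -> bfs E' x k = (B, S).
Proof.
elim: k B S => [//|k IH] B S EE'.
rewrite /bfs !iterS -/(bfs _ _ _) -/(bfs _ _ _) (bfs_eq E).
set B0 := ball E x k; set S0 := sphere E x k => -[eB eS].
have BS : B :\: S = B0.
  apply/setP=> v; rewrite -eB -eS !(in_setD, in_setU) /=.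
  by case: (v \in B0); case: (v \in neighbours _ _).
have agree (A : {set 'I_n}) : A \subset B0 -> E :&: touching A = E' :&: touching A.
  move=> AB; apply/setP=> d; rewrite !in_setI.
  case: (boolP (d \in touching A)) => [dA|_]; last by rewrite !andbF.
  have dB : d \in touching B0.
    move: dA; rewrite !inE => /set0Pn[v]; rewrite inE => /andP[vd vA].
    by apply/set0Pn; exists v; rewrite inE vd (subsetP AB).
  have := congr1 (fun D : {set {set 'I_n}} => d \in D) EE'.
  by rewrite BS !in_setI dB !andbT.
rewrite (IH B0 S0) ?bfs_eq //; last by apply: agree; rewrite subsetDl.
rewrite /explore /= -(neighbours_eq (agree S0 (sphere_ball _ _ _))).
by rewrite -eB -eS.
Qed.

Definition spans S (B : {set 'I_n}) : {set {set 'I_n}} :=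
  [set [set u; v] | u in S, v in B].

Lemma card_spans S B : (#|spans S B| <= #|S| * n)%N.
Proof.
rewrite /spans curry_imset2X (leq_trans (leq_imset_card _ _)) // cardsX leq_mul2l.
by rewrite (leq_trans (max_card _)) ?card_ord ?orbT.
Qed.

Lemma card_spans_disjoint S B : [disjoint S & B] ->
  #|spans S B| = (#|S| * #|B|)%N.
Proof.
move=> /pred0P dSB; rewrite /spans curry_imset2X card_in_imset ?cardsX //.
case=> u v [u' v']; rewrite !in_setX /= => /andP[uS vB] /andP[uS' vB'] eq.
have uv' : u != v'.
  by apply/eqP => uv; have := dSB u; rewrite /= uS uv vB'.
have u'v : u' != v.
  by apply/eqP => uv; have := dSB u'; rewrite /= uS' uv vB.
have : u \in [set u'; v'] by rewrite -eq !inE eqxx.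
have : v \in [set u'; v'] by rewrite -eq !inE eqxx orbT.
rewrite !inE eq_sym (negbTE u'v) (negbTE uv') orbF /=.
by move=> /eqP -> /eqP ->.
Qed.

Lemma spans_pairs S B : [disjoint S & B] -> spans S B \subset vertex_pairs n.
Proof.
move=> /pred0P dSB; apply/subsetP => d /imset2P[u v uS vB ->].
rewrite inE cards2; case: (eqVneq u v) => //= uv; have := dSB u.
by rewrite /= uS uv vB.
Qed.

Lemma count_pairs (D : {set {set 'I_n}}) : D \subset vertex_pairs n ->
  count (mem D) (enum (vertex_pairs n)) = #|D|.
Proof.
move=> DP; rewrite -size_filter cardE; apply/perm_size/uniq_perm.
- by rewrite filter_uniq ?enum_uniq.
- exact: enum_uniq.
move=> d; rewrite mem_filter !mem_enum inE; case: (boolP (d \in D)) => //= dD.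
exact: (subsetP DP).
Qed.

Lemma count_le (D : {set {set 'I_n}}) (l : seq {set 'I_n}) : uniq l ->
  (count (mem D) l <= #|D|)%N.
Proof.
move=> ul; rewrite -size_filter cardE uniq_leq_size ?filter_uniq //.
by move=> d; rewrite mem_filter mem_enum => /andP[].
Qed.

(** Sending an edge between [S] and the outside of [B] to its endpoint outside [B] hits every new
    neighbour. *)
Lemma card_new_neighbours E B S : S \subset B ->
  (#|neighbours E S :\: B| <= #|E :&: spans S (~: B)|)%N.
Proof.
move=> SB; pose f (d : {set 'I_n}) := [pick v in d :\: B].
rewrite -(card_imset _ (@Some_inj _)) (leq_trans _ (leq_imset_card f _)) //.
apply/subset_leq_card/subsetP => _ /imsetP[v vN ->].
move: vN; rewrite !inE => /andP[vB /existsP[u /and3P[uS uv uvE]]].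
apply/imsetP; exists [set u; v].
  by rewrite inE uvE; apply/imset2P; exists u v; rewrite ?inE.
have eD : [set u; v] :\: B = [set v].
  apply/setP=> w; rewrite !inE; case: eqP => [->|_] /=.
    by rewrite (subsetP SB) //=; apply/esym/negbTE.
  by case: eqP => [->|]; rewrite ?vB ?andbF.
by rewrite /f eD; case: pickP => [w|/(_ v)]; rewrite inE ?eqxx // => /eqP ->.
Qed.

(** Neither endpoint of such a pair has been expanded, so the pair is still unexposed. All
    independence between successive spheres comes from here. *)
Lemma spans_untouched S B : S \subset B -> forall d,
  d \in spans S (~: B) -> d \notin touching (B :\: S).
Proof.
move=> SB d /imset2P[u v uS vB ->]; rewrite inE negbK -subset0.
apply/subsetP=> w; rewrite !inE in vB *.
by case/andP=> /orP[] /eqP -> /andP[]; rewrite ?uS ?(negbTE vB).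
Qed.

End Exploration.

(** * Moments of the spheres *)

(** A rational substitute for the bound exp(- p N), valid in every ordered field. *)
Lemma expn1B_le (R : realFieldType) (p : R) N :
  0 <= p -> p <= 1 -> (1 - p) ^+ N * (1 + p * N%:R) <= 1.
Proof.
move=> p0 p1; elim: N => [|N IH]; first by rewrite expr0 mulr0 addr0 mulr1.
apply: le_trans IH; rewrite exprSr -mulrA ler_wpM2l ?exprn_ge0 ?subr_ge0 //.
rewrite -natr1; have : 0 <= p * p * (N%:R + 1) by rewrite !mulr_ge0 // addr_ge0.
lra.
Qed.

Lemma sumr_indic (R : pzRingType) (T : finType) (a : T) (F : T -> R) :
  \sum_b (a == b)%:R * F b = F a.
Proof.
rewrite (bigD1 a) //= eqxx mul1r big1 ?addr0 // => b ba.
by rewrite eq_sym (negbTE ba) mul0r.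
Qed.

Lemma new_neighbours_local n (E : {set {set 'I_n}}) (B S : {set 'I_n}) :
  S \subset B ->
  neighbours E S :\: B = neighbours (E :\: touching (B :\: S)) S :\: B.
Proof.
move=> SB; apply/setP=> v; rewrite !in_setD; case: (boolP (v \in B)) => //= vB.
rewrite !in_set; apply: eq_existsb => u; case: (boolP (u \in S)) => //= uS.
rewrite /adj /= in_setD (spans_untouched SB) //.
by apply/imset2P; exists u v; rewrite ?inE.
Qed.

Section Spheres.
Variables (R : realFieldType) (n : nat) (p : R).
Hypotheses (p_ge0 : 0 <= p) (p_le1 : p <= 1).
Implicit Types (E : {set {set 'I_n}}) (B S : {set 'I_n}) (x y : 'I_n).

Let lam : R := n%:R * p.
Notation Ex := (expect p (enum (vertex_pairs n))).

Let lam_ge0 : 0 <= lam. Proof. by rewrite mulr_ge0. Qed.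

Let Ule F G : (forall E, F E <= G E) -> Ex F <= Ex G.
Proof. exact: le_expect. Qed.

Lemma bfs_indic_local x k BS E :
  (bfs E x k == BS)%:R = (bfs (E :&: touching (BS.1 :\: BS.2)) x k == BS)%:R :> R.
Proof.
case: BS => B S /=; congr (nat_of_bool _)%:R.
by apply/eqP/eqP; apply: bfs_local; rewrite -setIA setIid.
Qed.

(** A Markov property. The event that the exploration is in state (B, S) depends only on pairs
    touching [B :\: S], and the next sphere only on the other pairs; so a bound for fixed (B, S) can
    be averaged over all states. *)
Lemma le_expect_sphereS x k (h : nat -> R) (phi : nat -> nat -> R) :
  (forall B S, S \subset B ->
     Ex (fun E => h #|neighbours E S :\: B|) <= phi #|B| #|S|) ->
  Ex (fun E => h #|sphere E x k.+1|) <=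
  Ex (fun E => phi #|ball E x k| #|sphere E x k|).
Proof.
move=> hphi.
have -> : Ex (fun E => h #|sphere E x k.+1|) =
    Ex (fun E => \sum_BS (bfs E x k == BS)%:R * h #|neighbours E BS.2 :\: BS.1|).
  by apply: eq_expect => E _; rewrite sumr_indic bfs_eq.
have -> : Ex (fun E => phi #|ball E x k| #|sphere E x k|) =
    Ex (fun E => \sum_BS (bfs E x k == BS)%:R * phi #|BS.1| #|BS.2|).
  by apply: eq_expect => E _; rewrite sumr_indic bfs_eq.
rewrite !expect_sum; apply: ler_sum => -[B S] _ /=.
have [SB|nSB] := boolP (S \subset B); last first.
  have z E : (bfs E x k == (B, S))%:R = 0 :> R.
    case: eqP => // eBS; case/negP: nSB.
    have := sphere_ball E x k; by rewrite /sphere /ball eBS.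
  by rewrite le_eqVlt; apply/orP; left; apply/eqP/eq_expect => E _; rewrite z !mul0r.
rewrite (@expect_indep _ _ p _ (touching (B :\: S))); first last.
- by move=> E; rewrite -new_neighbours_local.
- by move=> E; rewrite (bfs_indic_local x k (B, S)).
have -> : Ex (fun E => (bfs E x k == (B, S))%:R * phi #|B| #|S|) =
    Ex (fun E => (bfs E x k == (B, S))%:R) * phi #|B| #|S|.
  by rewrite mulrC -expectZ; apply: eq_expect => E _; rewrite mulrC.
by apply: ler_wpM2l; [exact: expect_ge0 | exact: hphi].
Qed.

Section NewNeighbours.
Variables (B S : {set 'I_n}).
Hypothesis SB : S \subset B.
Let D := spans S (~: B).
Let l := enum (vertex_pairs n).

Let uniq_l : uniq l. Proof. exact: enum_uniq. Qed.

Let le_count : p * (count (mem D) l)%:R <= lam * #|S|%:R.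
Proof.
rewrite /lam mulrAC -[leRHS]mulrC ler_wpM2l // -natrM ler_nat mulnC.
exact: leq_trans (count_le _ _) (card_spans _ _).
Qed.

Lemma expect_new_neighbours : Ex (fun E => #|neighbours E S :\: B|%:R) <= lam * #|S|%:R.
Proof.
apply: le_trans le_count; rewrite -expect_card //; apply: Ule => E.
by rewrite ler_nat card_new_neighbours.
Qed.

Lemma expect_new_neighbours2 : Ex (fun E => #|neighbours E S :\: B|%:R ^+ 2) <=
  lam * #|S|%:R + (lam * #|S|%:R) ^+ 2.
Proof.
apply: (@le_trans _ _ (Ex (fun E => #|E :&: D|%:R ^+ 2))).
  by apply: Ule => E; rewrite lerXn2r ?nnegrE // ler_nat card_new_neighbours.
rewrite expect_card2 //; apply: lerD.
  apply: le_trans le_count; rewrite mulrAC ler_piMr ?mulr_ge0 //.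
  by rewrite lerBlDr lerDl.
by rewrite lerXn2r ?nnegrE ?mulr_ge0.
Qed.

Lemma expect_new_neighbours_expn c : 0 <= c ->
  Ex (fun E => (1 + c) ^+ #|neighbours E S :\: B|) <= ((1 + c * p) ^+ n) ^+ #|S|.
Proof.
move=> c0; apply: (@le_trans _ _ (Ex (fun E => (1 + c) ^+ #|E :&: D|))).
  by apply: Ule => E; rewrite ler_weXn2l ?lerDl // card_new_neighbours.
rewrite expect_expn // (_ : 1 - p + p * (1 + c) = 1 + c * p); last by ring.
rewrite -exprM ler_weXn2l ?lerDl ?mulr_ge0 // mulnC.
exact: leq_trans (count_le _ _) (card_spans _ _).
Qed.

(** With z = p |S|, a vertex outside [B] is missed with probability (1 - p)^|S| <= 1 / (1 + z),
    hence hit with probability at least z / (1 + z) >= z - z^2. *)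
Lemma expect_new_neighbours_ge :
  (n%:R - #|B|%:R) * (p * #|S|%:R - (p * #|S|%:R) ^+ 2) <=
  Ex (fun E => #|neighbours E S :\: B|%:R).
Proof.
have -> : Ex (fun E => #|neighbours E S :\: B|%:R) =
    Ex (fun E => \sum_(v in ~: B) (v \in neighbours E S)%:R).
  apply: eq_expect => E _; rewrite -sum1_card natr_sum [RHS]big_mkcond [LHS]big_mkcond /=.
  apply: eq_bigr => v _; rewrite in_setD in_setC.
  by case: (v \in B); case: (v \in neighbours E S).
rewrite expect_sum.
have -> : n%:R - #|B|%:R = \sum_(v in ~: B) 1 :> R.
  by rewrite sumr_const -{1}(card_ord n) -(cardsC B) natrD addrAC subrr add0r.
rewrite mulr_suml; apply: ler_sum => v; rewrite in_setC mul1r => vB.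
have vS : [disjoint S & [set v]].
  by rewrite disjoint_sym disjoints1; apply: contra vB; apply: subsetP.
(* Since 0^0 = 1, the power of 0 is the indicator that no pair joining [v] to [S] is present. *)
have -> : Ex (fun E => (v \in neighbours E S)%:R) =
    Ex (fun E => 1 + (-1) * 0 ^+ #|E :&: spans S [set v]|).
  apply: eq_expect => E _; have -> : (v \in neighbours E S) = (#|E :&: spans S [set v]| != 0)%N.
    rewrite cards_eq0; apply/idP/set0Pn.
      rewrite inE => /existsP[u /and3P[uS _ uv]]; exists [set u; v].
      by rewrite inE uv; apply/imset2P; exists u v; rewrite ?inE.
    case=> d; rewrite inE => /andP[dE /imset2P[u w uS /set1P wv dd]].
    apply: (@mem_neighbours _ E S u) => //; rewrite /adj /= -wv -dd dE andbT.
    apply/eqP=> uw; move/pred0P: vS => /(_ v); rewrite /= inE eqxx andbT.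
    by rewrite -wv -uw uS.
  by rewrite expr0n; case: (_ == _) => /=; ring.
rewrite expectD expectZ expect_cst expect_expn // count_pairs ?spans_pairs //.
rewrite card_spans_disjoint // cards1 muln1 mulr0 addr0 mulN1r.
have := expn1B_le #|S| p_ge0 p_le1; set q := _ ^+ _.
have : 0 <= q by rewrite exprn_ge0 // subr_ge0.
have : 0 <= p * #|S|%:R by rewrite mulr_ge0.
move: (p * _) => z z0 q0 h; have : 0 <= q * z ^+ 2 * z by rewrite !mulr_ge0 ?sqr_ge0.
nra.
Qed.

End NewNeighbours.

Lemma sphere0 E x : sphere E x 0 = [set x]. Proof. by []. Qed.

Lemma expect_sphere x k : Ex (fun E => #|sphere E x k|%:R) <= lam ^+ k.
Proof.
elim: k => [|k IH].
  rewrite expr0 -[leRHS](expect_cst p (enum (vertex_pairs n))); apply: Ule => E.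
  by rewrite sphere0 cards1.
rewrite exprS; apply: le_trans (ler_wpM2l lam_ge0 IH); rewrite -expectZ.
by apply: (@le_expect_sphereS x k _ (fun b s => lam * s%:R)) => B S; exact: expect_new_neighbours.
Qed.

(** The bound is the second moment of a Galton-Watson process with Poisson offspring of mean [lam]:
    both solve m(k + 1) = lam^(k + 1) + lam^2 m(k). *)
Lemma expect_sphere2 x k : 1 < lam ->
  Ex (fun E => #|sphere E x k|%:R ^+ 2) <= lam ^+ k * (lam ^+ k.+1 - 1) / (lam - 1).
Proof.
move=> lam1; have l0 : lam - 1 != 0 by rewrite subr_eq0 gt_eqF.
elim: k => [|k IH].
  rewrite expr0 mul1r expr1 divff // -[leRHS](expect_cst p (enum (vertex_pairs n))).
  by apply: Ule => E; rewrite sphere0 cards1 expr1n.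
apply: (@le_trans _ _ (Ex (fun E => lam * #|sphere E x k|%:R +
    lam ^+ 2 * #|sphere E x k|%:R ^+ 2))).
  apply: (@le_expect_sphereS x k (fun s => s%:R ^+ 2)
    (fun b s => lam * s%:R + lam ^+ 2 * s%:R ^+ 2)) => B S SB.
  by rewrite -exprMn; exact: expect_new_neighbours2.
rewrite expectD !expectZ.
have h1 := ler_wpM2l lam_ge0 (expect_sphere x k).
have h2 := ler_wpM2l (sqr_ge0 lam) IH.
apply: le_trans (lerD h1 h2) _; rewrite le_eqVlt; apply/orP; left; apply/eqP.
rewrite !exprS; field.
by rewrite l0.
Qed.

(** The right-hand side is 1 / (1 - lam c), a rational majorant of exp(lam c); the induction is on
    the number of factors. *)
Lemma expn_1D_le (c : R) : 0 < c -> lam * c < 1 ->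
  (1 + c * p) ^+ n <= 1 + lam * c / (1 - lam * c).
Proof.
move=> c0 lc.
have h : 0 < 1 - lam * c by rewrite subr_gt0.
have key m : (m%:R * p * c) < 1 -> (1 + c * p) ^+ m * (1 - m%:R * p * c) <= 1.
  elim: m => [|m IH]; first by rewrite expr0 !mul0r subr0 mulr1.
  rewrite -natr1 => hm; have pc : 0 <= p * c by rewrite mulr_ge0 // ltW.
  have hm' : m%:R * p * c < 1 by nra.
  apply: le_trans (IH hm'); rewrite exprSr -mulrA ler_wpM2l //.
    by rewrite exprn_ge0 // addr_ge0 // mulrC.
  have : 0 <= m%:R * (p * c) * (p * c) by apply: mulr_ge0 => //; apply: mulr_ge0.
  nra.
have -> : 1 + lam * c / (1 - lam * c) = (1 - lam * c)^-1.
  by field; rewrite gt_eqF.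
by rewrite -[leRHS]mul1r ler_pdivlMr // key.
Qed.

(* Exposing one sphere turns (1 + 1/d) ^ s into at most (1 + 1/d') ^ s with
   d' = d / lam - 1, so that d + 2 loses at most a factor lam at each step. *)
Lemma expect_sphere_expn x k (d : R) : 2 <= lam -> 3 * lam ^+ k <= d + 2 ->
  Ex (fun E => (1 + d^-1) ^+ #|sphere E x k|) <= 2.
Proof.
move=> lam2; have l0 : 0 < lam by lra.
elim: k d => [|k IH] d hd.
  rewrite -[leRHS](expect_cst p (enum (vertex_pairs n))).
  apply: Ule => E; rewrite sphere0 cards1 expr1.
  have d1 : 1 <= d by rewrite expr0 in hd; lra.
  have : d^-1 <= 1 by rewrite invf_le1 //; lra.
  lra.
have lk : 1 <= lam ^+ k by rewrite exprn_ege1 //; lra.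
have ll : lam <= lam * lam ^+ k by nra.
rewrite exprS in hd.
have d0 : 0 < d by nra.
set d' := d / lam - 1.
have d'2 : 3 * lam ^+ k <= d' + 2.
  have : 3 * lam ^+ k <= (d + 2) / lam by rewrite ler_pdivlMr //; nra.
  have : 2 / lam <= 1 by rewrite ler_pdivrMr //; lra.
  rewrite /d'; lra.
have d'0 : 0 < d' by lra.
have ld1 : lam * d^-1 < 1 by rewrite ltr_pdivrMr // mul1r; nra.
apply: le_trans (IH _ d'2).
apply: (@le_expect_sphereS x k (fun s => (1 + d^-1) ^+ s) (fun b s => (1 + d'^-1) ^+ s)).
move=> B S SB; apply: le_trans (expect_new_neighbours_expn SB _) _.
  by rewrite invr_ge0 ltW.
rewrite lerXn2r ?nnegrE ?exprn_ge0 ?addr_ge0 ?mulr_ge0 ?invr_ge0 ?(ltW d0) ?(ltW d'0) //.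
apply: le_trans (expn_1D_le _ ld1) _; first by rewrite invr_gt0.
rewrite lerD2l le_eqVlt; apply/orP; left; apply/eqP.
have dl : d - lam != 0 by rewrite gt_eqF // subr_gt0; nra.
have -> : d' = (d - lam) / lam by rewrite /d'; field; rewrite gt_eqF.
by field; rewrite dl !gt_eqF.
Qed.

(** The exponential moment at scale d = 3 lam^k controls the fourth one: with c = 1/d, Bernoulli's
    inequality gives (c s / 8)^4 <= (1 + c/8)^(4 s) <= (1 + c)^s. The constant 24 is 8 times 3. *)
Lemma expect_sphere4 x k : 2 <= lam ->
  Ex (fun E => #|sphere E x k|%:R ^+ 4) <= 2 * 24 ^+ 4 * lam ^+ k ^+ 4.
Proof.
move=> lam2; have l0 : 0 < lam by lra.
have lk : 1 <= lam ^+ k by rewrite exprn_ege1 //; lra.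
set d := 3 * lam ^+ k.
have d0 : 0 < d by rewrite /d; lra.
have hd : 3 * lam ^+ k <= d + 2 by rewrite /d; lra.
have := ler_wpM2l (exprn_ge0 4 (ltW (mulr_gt0 (ltr0n R 8) d0))) (expect_sphere_expn x lam2 hd).
rewrite -expectZ => h; apply: le_trans (le_trans h _); last first.
  by rewrite /d le_eqVlt; apply/orP; left; apply/eqP; ring.
apply: Ule => E; set s := #|_|; set c := d^-1.
have c0 : 0 <= c by rewrite invr_ge0 ltW.
have c1 : c <= 1 by rewrite invf_le1 // /d; lra.
have h1 : (1 + c / 8) ^+ 4 <= 1 + c.
  have c2 : c * c <= c by nra.
  have c3 : c * c * c <= c by nra.
  have c4 : c * c * c * c <= c by nra.
  have -> : (1 + c / 8) ^+ 4 = 1 + c / 2 + 6 / 64 * (c * c) + 4 / 512 * (c * c * c) +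
     (c * c * c * c) / 4096 by field.
  lra.
have h2 : (c / 8 * s%:R) ^+ 4 <= (1 + c) ^+ s.
  have bern (N : nat) : 1 + c / 8 * N%:R <= (1 + c / 8) ^+ N.
    elim: N => [|N IH]; first by rewrite mulr0 expr0; lra.
    have c8 : 0 <= 1 + c / 8 by lra.
    rewrite exprS -[N.+1]addn1 natrD; apply: (le_trans _ (ler_wpM2l c8 IH)).
    have : 0 <= (c / 8) * (c / 8) * N%:R by apply: mulr_ge0 => //; apply: mulr_ge0; lra.
    lra.
  have c8 : 0 <= c / 8 by lra.
  have c9 : 0 <= 1 + c / 8 by lra.
  apply: (@le_trans _ _ (((1 + c / 8) ^+ s) ^+ 4)).
    apply: lerXn2r; rewrite ?nnegrE; [exact: mulr_ge0|exact: exprn_ge0|].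
    by apply: le_trans (bern s); rewrite lerDr.
  rewrite -exprM mulnC exprM; apply: lerXn2r; rewrite ?nnegrE //.
    exact: exprn_ge0.
  by rewrite addr_ge0.
have -> : s%:R ^+ 4 = (8 * d) ^+ 4 * (c / 8 * s%:R) ^+ 4.
  by rewrite /c; field; rewrite gt_eqF.
by apply: (ler_wpM2l _ h2); rewrite exprn_ge0 // mulr_ge0 // ltW.
Qed.

(** A ball is at most k + 1 times its largest sphere, which costs (k + 1)^4; summing over the
    spheres costs one more factor. *)
Lemma expect_ball4 x k : 2 <= lam ->
  Ex (fun E => #|ball E x k|%:R ^+ 4) <=
  2 * 24 ^+ 4 * k.+1%:R ^+ 5 * lam ^+ k ^+ 4.
Proof.
move=> lam2; have lam1 : 1 <= lam by lra.
have pm E : #|ball E x k|%:R ^+ 4 <=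
    k.+1%:R ^+ 4 * \sum_(j < k.+1) #|sphere E x j|%:R ^+ 4 :> R.
  have [j0 hj0] : exists j0 : 'I_k.+1, forall j : 'I_k.+1,
      (#|sphere E x j| <= #|sphere E x j0|)%N.
    case: (@arg_maxnP _ ord0 xpredT (fun j : 'I_k.+1 => #|sphere E x j|) isT) => j0 _ hj0.
    by exists j0 => j; apply: hj0.
  have : (#|ball E x k| <= k.+1 * #|sphere E x j0|)%N.
    have -> : (k.+1 * #|sphere E x j0| = \sum_(j < k.+1) #|sphere E x j0|)%N.
      by rewrite sum_nat_const card_ord.
    rewrite card_ball.
    by apply: leq_sum => j _; exact: hj0.
  rewrite -(ler_nat R) => h; apply: (@le_trans _ _ ((k.+1 * #|sphere E x j0|)%:R ^+ 4)).
    by rewrite lerXn2r ?nnegrE.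
  rewrite natrM exprMn ler_wpM2l ?exprn_ge0 // (bigD1 j0) //= lerDl.
  by apply: sumr_ge0 => j _; rewrite exprn_ge0.
apply: (@le_trans _ _ (Ex (fun E => k.+1%:R ^+ 4 * \sum_(j < k.+1) #|sphere E x j|%:R ^+ 4))).
  exact: Ule.
rewrite expectZ expect_sum.
apply: (@le_trans _ _ (k.+1%:R ^+ 4 * \sum_(j < k.+1) (2 * 24 ^+ 4 * lam ^+ k ^+ 4))).
  rewrite ler_wpM2l ?exprn_ge0 //; apply: ler_sum => j _.
  apply: le_trans (expect_sphere4 x j lam2) _; rewrite ler_wpM2l ?mulr_ge0 ?exprn_ge0 //.
  rewrite lerXn2r ?nnegrE ?exprn_ge0 // ler_weXn2l // -ltnS; exact: ltn_ord.
rewrite sumr_const card_ord -[X in _ * X]mulr_natr le_eqVlt; apply/orP; left; apply/eqP.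
ring.
Qed.

(** Two losses occur at each step: at most lam p s^2 for new vertices hit several times, and p b s
    for vertices already in the ball. Both have expectation of order p lam^(2 k), up to a factor
    linear in k, and the subtracted term accumulates them. *)
Lemma expect_sphere_ge x k : 2 <= lam ->
  lam ^+ k - p * (k%:R * (4 * k%:R + 2 * lam) * lam ^+ k ^+ 2) <=
  Ex (fun E => #|sphere E x k|%:R).
Proof.
move=> lam2; have lam1 : 1 < lam by lra.
have s2 j : Ex (fun E => #|sphere E x j|%:R ^+ 2) <= 2 * lam ^+ j ^+ 2.
  apply: le_trans (expect_sphere2 x j lam1) _; rewrite ler_pdivrMr ?subr_gt0 //.
  have : 0 <= lam ^+ j by rewrite exprn_ge0.
  rewrite exprS; move: (lam ^+ j) => z z0; have : 0 <= z * z by rewrite mulr_ge0.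
  nra.
elim: k => [|k IH].
  rewrite expr0 !mul0r mulr0 subr0 -[leLHS](expect_cst p (enum (vertex_pairs n))).
  by apply: Ule => E; rewrite sphere0 cards1.
have step : Ex (fun E => lam * #|sphere E x k|%:R -
    (lam * p * #|sphere E x k|%:R ^+ 2 + p * (#|ball E x k|%:R * #|sphere E x k|%:R)))
    <= Ex (fun E => #|sphere E x k.+1|%:R).
  rewrite -lerN2.
  have oppE F : - Ex F = Ex (fun E => - F E).
    by rewrite -mulN1r -expectZ; apply: eq_expect => E _; rewrite mulN1r.
  rewrite !oppE; apply: (@le_expect_sphereS x k (fun s => - s%:R) (fun b s =>
     - (lam * s%:R - (lam * p * s%:R ^+ 2 + p * (b%:R * s%:R))))) => B S SB.
  rewrite -oppE lerN2; apply: le_trans (expect_new_neighbours_ge SB).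
  have : 0 <= #|B|%:R * (p * #|S|%:R) ^+ 2 by rewrite mulr_ge0 ?sqr_ge0.
  rewrite /lam; nra.
apply: le_trans step.
have bs : Ex (fun E => #|ball E x k|%:R * #|sphere E x k|%:R) <= 4 * k.+1%:R * lam ^+ k ^+ 2.
  have -> : Ex (fun E => #|ball E x k|%:R * #|sphere E x k|%:R) =
     Ex (fun E => \sum_(j < k.+1) #|sphere E x j|%:R * #|sphere E x k|%:R).
    by apply: eq_expect => E _; rewrite card_ball natr_sum mulr_suml.
  rewrite expect_sum.
  have -> : 4 * k.+1%:R * lam ^+ k ^+ 2 = \sum_(j < k.+1) (4 * lam ^+ k ^+ 2).
    by rewrite sumr_const card_ord -[RHS]mulr_natr; ring.
  apply: ler_sum => j _.
  apply: (@le_trans _ _ (Ex (fun E => #|sphere E x j|%:R ^+ 2 + #|sphere E x k|%:R ^+ 2))).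
    apply: Ule => E; move: (#|_|%:R) (#|_|%:R) => a b; nra.
  rewrite expectD; have := s2 j; have := s2 k.
  have : lam ^+ j ^+ 2 <= lam ^+ k ^+ 2.
    rewrite lerXn2r ?nnegrE ?exprn_ge0 // ler_weXn2l //; first exact: ltW.
    by rewrite -ltnS; exact: ltn_ord.
  lra.
have -> : Ex (fun E => lam * #|sphere E x k|%:R -
    (lam * p * #|sphere E x k|%:R ^+ 2 + p * (#|ball E x k|%:R * #|sphere E x k|%:R))) =
  lam * Ex (fun E => #|sphere E x k|%:R) + ((- (lam * p)) * Ex (fun E => #|sphere E x k|%:R ^+ 2)
   + (-p) * Ex (fun E => #|ball E x k|%:R * #|sphere E x k|%:R)).
  by rewrite -!expectZ -!expectD; apply: eq_expect => E _; ring.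
have h1 := ler_wpM2l lam_ge0 IH.
have h2 := ler_wpM2l (mulr_ge0 lam_ge0 p_ge0) (s2 k).
have h3 := ler_wpM2l p_ge0 bs.
apply: (@le_trans _ _ (lam * (lam ^+ k - p * (k%:R * (4 * k%:R + 2 * lam) * lam ^+ k ^+ 2))
  - lam * p * (2 * lam ^+ k ^+ 2) - p * (4 * k.+1%:R * lam ^+ k ^+ 2))); last by lra.
rewrite exprS -[k.+1]addn1 !natrD; move: (lam ^+ k) (k%:R : R) (exprn_ge0 k lam_ge0) (ler0n R k) => z K z0 K0.
rewrite -subr_ge0.
set rhs := (X in 0 <= X).
have -> : rhs = p * z ^+ 2 * ((lam ^+ 2 - lam) * (K * (4 * K + 2 * lam)) +
    ((lam ^+ 2 - 1) * (8 * K + 4 + 2 * lam) + 4 * K)) by rewrite /rhs; ring.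
have l2 : 0 <= lam ^+ 2 - lam by nra.
have l3 : 0 <= lam ^+ 2 - 1 by nra.
apply: mulr_ge0; first by rewrite mulr_ge0 ?sqr_ge0.
apply: addr_ge0.
  by apply: mulr_ge0 => //; apply: mulr_ge0 => //; lra.
by apply: addr_ge0; [apply: mulr_ge0 => //; lra | lra].
Qed.

End Spheres.

(** * Close pairs and bad triples *)

Lemma sqr_sum_le (R : realFieldType) (I : finType) (a : I -> R) :
  (\sum_i a i) ^+ 2 <= #|I|%:R * \sum_i a i ^+ 2.
Proof.
rewrite expr2 big_distrlr /=.
have -> : #|I|%:R * \sum_i a i ^+ 2 = \sum_i \sum_j (a i ^+ 2 + a j ^+ 2) / 2.
  have -> : \sum_i \sum_j (a i ^+ 2 + a j ^+ 2) / 2 =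
     \sum_i (#|I|%:R * (a i ^+ 2 / 2) + (\sum_j a j ^+ 2) / 2).
    apply: eq_bigr => i _; rewrite -mulr_suml big_split /= sumr_const.
    by rewrite -[_ *+ _]mulr_natl; field.
  by rewrite big_split /= -mulr_sumr sumr_const -mulr_suml -[_ *+ _]mulr_natl; field.
apply: ler_sum => i _; apply: ler_sum => j _.
have := sqr_ge0 (a i - a j); lra.
Qed.

Section FarPairs.
Variables (n : nat) (E : {set {set 'I_n}}).
Implicit Types (x y u v : 'I_n).

Lemma reach_meet a x y z : z \in ball E x a -> z \in ball E y a ->
  reach (adj E) (2 * a)%N.+1 x y.
Proof.
rewrite !in_ball => xz yz; rewrite reach_sym in yz; last exact: adj_sym.
by apply: reach_leq (reach_trans xz yz); lia.
Qed.

Lemma far_spheres a x y : ~~ reach (adj E) (2 * a)%N.+1 x y ->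
  [disjoint ball E x a & ball E y a] /\
  E :&: spans (sphere E x a) (sphere E y a) = set0.
Proof.
move=> far; have dis : [disjoint ball E x a & ball E y a].
  apply/pred0P => z /=; apply/negP => /andP[zx zy].
  by case/negP: far; apply: reach_meet zx zy.
split=> //; apply/setP=> d; rewrite in_set0; apply/negP.
rewrite in_setI => /andP[dE /imset2P[u v uS vS dd]]; case/negP: far.
have uB := subsetP (sphere_ball E x a) _ uS.
have vB := subsetP (sphere_ball E y a) _ vS.
have uv : adj E u v.
  rewrite /adj /= -dd dE andbT; apply/eqP => uv.
  by move/pred0P: dis => /(_ u) /=; rewrite uB uv vB.
rewrite !in_ball in uB vB; rewrite reach_sym in vB; last exact: adj_sym.
by apply: reach_leq (reach_trans (reach_step uB uv) vB); lia.
Qed.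

Lemma adj_add_edge u v w z : adj ([set u; v] |: E) w z ->
  adj (E :\ [set u; v]) w z \/ (w = u /\ z = v) \/ (w = v /\ z = u).
Proof.
rewrite /adj /= !inE; case/andP=> wz; rewrite wz /=.
case: (eqVneq [set w; z] [set u; v]) => [eq _|_ /= ->]; last by left.
right; have : w \in [set u; v] by rewrite -eq !inE eqxx.
have : z \in [set u; v] by rewrite -eq !inE eqxx orbT.
rewrite !inE => /orP[]/eqP zE /orP[]/eqP wE; rewrite zE wE ?eqxx in wz *; by [|left|right].
Qed.

(* A walk that gets shorter thanks to the pair uv splits at its first and last
   passage through that pair. *)
Lemma reach_add_edge u v k x y : reach (adj ([set u; v] |: E)) k x y ->
  let r := reach (adj (E :\ [set u; v])) in
  r k x y \/ exists i j, (i + j < k)%N /\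
    ((r i x u /\ r j v y) \/ (r i x v /\ r j u y)).
Proof.
move=> + r; elim: k y => [|k IH] y; first by left.
case/reachSP => [/IH[h|[i [j [ij h]]]]|[z /IH h /adj_add_edge zy]].
- by left; exact: reach_leq h.
- by right; exists i, j; split=> //; exact: leqW.
case: h => [xz|[i [j [ij h]]]].
  case: zy => [zy|[[zu yv]|[zv yu]]]; first by left; exact: reach_step zy.
    right; exists k, 0%N; split; first by rewrite addn0.
    by left; rewrite -zu yv; split => //; exact: reach_refl.
  right; exists k, 0%N; split; first by rewrite addn0.
  by right; rewrite -zv yu; split => //; exact: reach_refl.
case: zy => [zy|zy].
  right; exists i, j.+1; split; first by rewrite addnS.
  by case: h => -[h1 h2]; [left|right]; split=> //; exact: reach_step zy.
have yuv : y = u \/ y = v by case: zy => -[_ ->]; [right|left].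
have ik : (i <= k.+1)%N by lia.
have i1 : (i + 0 < k.+1)%N by lia.
case: h => -[h1 h2]; case: yuv => ->.
- by left; exact: reach_leq h1.
- by right; exists i, 0%N; split=> //; left; split=> //; exact: reach_refl.
- by right; exists i, 0%N; split=> //; right; split=> //; exact: reach_refl.
- by left; exact: reach_leq h1.
Qed.

End FarPairs.

(** * Connection of large spheres, concentration of close pairs, first moment of bad triples *)

Section Estimates.
Variables (R : realFieldType) (n : nat) (p : R).
Hypotheses (p_ge0 : 0 <= p) (p_le1 : p <= 1).
Implicit Types (E : {set {set 'I_n}}) (B S : {set 'I_n}) (x y : 'I_n).

Let lam : R := n%:R * p.
Notation Ex := (expect p (enum (vertex_pairs n))).

Let Ule F G : (forall E, F E <= G E) -> Ex F <= Ex G.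
Proof. exact: le_expect. Qed.

(** A division-free Paley-Zygmund inequality, true pointwise: 2 t X - t^2 X^2 is at most 1, and 2 t
    (X - s) is negative or zero when X < s. The best [t] is (E X - s) / E X^2. *)
Lemma second_moment_bound (X : {set {set 'I_n}} -> R) (s t : R) :
  0 <= s -> 0 <= t ->
  2 * t * Ex X - t ^+ 2 * Ex (fun E => X E ^+ 2) - 2 * t * s <=
  Ex (fun E => (s <= X E)%R%:R).
Proof.
move=> s0 t0.
have -> : 2 * t * Ex X - t ^+ 2 * Ex (fun E => X E ^+ 2) - 2 * t * s =
   Ex (fun E => 2 * t * X E + (- t ^+ 2 * X E ^+ 2 + (- (2 * t * s)))).
  by rewrite !expectD !expectZ expect_cst; ring.
apply: Ule => E; have := sqr_ge0 (1 - t * X E); have := sqr_ge0 (t * X E).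
have ts : 0 <= t * s by exact: mulr_ge0.
case: (leP s (X E)) => h /=; first by lra.
have : 0 <= t * (s - X E) by apply: mulr_ge0 => //; lra.
lra.
Qed.

Lemma markov (X : {set {set 'I_n}} -> R) (c : R) :
  (forall E, 0 <= X E) -> 0 < c -> Ex (fun E => (c <= X E)%R%:R) <= Ex X / c.
Proof.
move=> X0 c0; rewrite ler_pdivlMr // mulrC -expectZ; apply: Ule => E.
by case: (leP c (X E)) => h; rewrite ?mulr1 ?mulr0.
Qed.

(** When the two balls are disjoint, the pairs between the two spheres are unexposed in both
    explorations, so they are independent of both states. *)
Lemma expect_pair_indic x y a (BS BS' : {set 'I_n} * {set 'I_n}) (b : bool) (c : R) :
  (b -> [disjoint BS.1 & BS'.1]) -> BS.2 \subset BS.1 -> BS'.2 \subset BS'.1 ->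
  (b -> (1 - p) ^+ #|spans BS.2 BS'.2| <= c) -> 0 <= c ->
  Ex (fun E => (bfs E x a == BS)%:R * (bfs E y a == BS')%:R * (b%:R *
    0 ^+ #|E :&: spans BS.2 BS'.2|)) <=
  Ex (fun E => (bfs E x a == BS)%:R * (bfs E y a == BS')%:R) * c.
Proof.
case: BS BS' => [B S] [B' S'] /=; case: b; last first.
  move=> _ _ _ _ c0; apply: le_trans (mulr_ge0 _ c0); last first.
    by apply: expect_ge0 => // E; rewrite mulr_ge0.
  by rewrite -[leRHS](expect_cst p (enum (vertex_pairs n))); apply: Ule => E; rewrite mul0r mulr0.
move=> /(_ isT) dis SB SB' /(_ isT) hc c0.
pose A := touching (B :\: S) :|: touching (B' :\: S').
have IA E (C : {set {set 'I_n}}) : C \subset A -> E :&: A :&: C = E :&: C.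
  by move=> CA; rewrite -setIA (setIidPr CA).
have loc z k B1 S1 E : touching (B1 :\: S1) \subset A ->
    (bfs E z k == (B1, S1)) = (bfs (E :&: A) z k == (B1, S1)).
  by move=> TA; apply/eqP/eqP; apply: bfs_local; rewrite IA.
have spA d : d \in spans S S' -> d \notin A.
  move=> dS; rewrite in_setU negb_or; apply/andP; split.
    apply: (spans_untouched SB); case/imset2P: dS => u v uS vS' ->.
    apply/imset2P; exists u v => //.
    by rewrite inE (disjointFl dis) // (subsetP SB').
  apply: (spans_untouched SB'); case/imset2P: dS => u v uS vS' ->.
  apply/imset2P; exists v u => //; last by rewrite setUC.
  by rewrite inE (disjointFr dis) // (subsetP SB).
rewrite (@expect_indep _ _ p _ A); first last.
- move=> E; have -> // : E :&: spans S S' = (E :\: A) :&: spans S S'.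
  apply/setP=> d; rewrite 2!in_setI in_setD.
  have [dS|_] := boolP (d \in spans S S'); last by rewrite !andbF.
  by rewrite (spA d dS).
- by move=> E; rewrite (loc x a B S E) ?subsetUl // (loc y a B' S' E) ?subsetUr.
apply: ler_wpM2l; first by apply: expect_ge0 => // E; rewrite mulr_ge0.
rewrite expectZ mul1r expect_expn ?enum_uniq // count_pairs.
  by rewrite mulr0 addr0.
apply: spans_pairs; apply: disjointWl SB (disjointWr SB' dis).
Qed.

(** If x and y are far apart, all pairs between their spheres are absent. Given two large spheres
    this has probability at most (1 - p)^(s^2); the states of both explorations are summed over. *)
Lemma expect_far x y a (s : R) : 0 <= s ->
  Ex (fun E => ((s <= #|sphere E x a|%:R) && (s <= #|sphere E y a|%:R) &&
     ~~ reach (adj E) (2 * a)%N.+1 x y)%R%:R) <= (1 + p * s ^+ 2)^-1.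
Proof.
move=> s0; set c := _^-1.
have c0' : 0 < 1 + p * s ^+ 2.
  by apply: ltr_pwDl => //; rewrite mulr_ge0 ?sqr_ge0.
have c0 : 0 <= c by rewrite invr_ge0 ltW.
pose good (BS BS' : {set 'I_n} * {set 'I_n}) :=
  [&& [disjoint BS.1 & BS'.1], BS.2 \subset BS.1, BS'.2 \subset BS'.1,
      s <= #|BS.2|%:R & s <= #|BS'.2|%:R].
pose q E BS BS' : R := (bfs E x a == BS)%:R * (bfs E y a == BS')%:R.
have sumq E (F : {set 'I_n} * {set 'I_n} -> {set 'I_n} * {set 'I_n} -> R) :
  \sum_BS \sum_BS' q E BS BS' * F BS BS' = F (bfs E x a) (bfs E y a).
  rewrite -[RHS](sumr_indic _ (fun b => F b (bfs E y a))); apply: eq_bigr => BS _.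
  rewrite -(sumr_indic (bfs E y a) (F BS)) mulr_sumr; apply: eq_bigr => BS' _.
  by rewrite mulrA.
apply: (@le_trans _ _ (Ex (fun E => \sum_BS \sum_BS' (q E BS BS' *
   ((good BS BS')%:R * 0 ^+ #|E :&: spans BS.2 BS'.2|))))).
  apply: Ule => E.
  rewrite (sumq E (fun BS BS' => (good BS BS')%:R * 0 ^+ #|E :&: spans BS.2 BS'.2|)).
  rewrite /good -/(ball E x a) -/(ball E y a) -/(sphere E x a) -/(sphere E y a) !sphere_ball.
  case: (boolP (reach _ _ _ _)) => [_|/far_spheres[-> ->]].
    by rewrite andbF mulr_ge0 ?exprn_ge0.
  by rewrite cards0 expr0 mulr1 andbT.
rewrite expect_sum.
apply: (@le_trans _ _ (\sum_BS \sum_BS' Ex (fun E => q E BS BS') * c)).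
  apply: ler_sum => BS _; rewrite expect_sum; apply: ler_sum => BS' _.
  have [g|/negbTE g] := boolP (good BS BS'); last first.
    rewrite (_ : Ex _ = 0); last first.
      rewrite -[RHS](expect_cst p (enum (vertex_pairs n))).
      by apply: eq_expect => E _; rewrite mul0r mulr0.
    by rewrite mulr_ge0 // expect_ge0 // => E; rewrite mulr_ge0.
  case/and5P: g => dis SB SB' h1 h2.
  apply: (@expect_pair_indic x y a BS BS' true) => // _.
  rewrite card_spans_disjoint; last by apply: disjointWl SB (disjointWr SB' dis).
  have := expn1B_le (#|BS.2| * #|BS'.2|) p_ge0 p_le1.
  rewrite -ler_pdivlMr; last by apply: ltr_pwDl => //; rewrite mulr_ge0.
  move/le_trans; apply; rewrite mul1r lef_pV2 ?posrE //; last first.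
    by apply: ltr_pwDl => //; rewrite mulr_ge0.
  by rewrite lerD2l ler_wpM2l // natrM expr2 ler_pM.
(* Once [c] is factored out, the total probability of all pairs of states remains, and it is 1. *)
under eq_bigr do rewrite -mulr_suml.
rewrite -mulr_suml -[leRHS]mul1r ler_wpM2r //.
under eq_bigr do rewrite -expect_sum.
rewrite -expect_sum -[leRHS](expect_cst p (enum (vertex_pairs n))); apply: Ule => E.
have := sumq E (fun _ _ => 1); under eq_bigr do under eq_bigr do rewrite mulr1.
by move=> ->.
Qed.

Lemma expect_reach_ge x y a (s c : R) : 0 <= s ->
  (forall z, c <= Ex (fun E => (s <= #|sphere E z a|%:R)%R%:R)) ->
  2 * c - 1 - (1 + p * s ^+ 2)^-1 <= Ex (fun E => (reach (adj E) (2 * a)%N.+1 x y)%:R).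
Proof.
move=> s0 hc; have h1 := hc x; have h2 := hc y; have h3 := expect_far x y a s0.
suff : Ex (fun E => (s <= #|sphere E x a|%:R)%R%:R) +
       Ex (fun E => (s <= #|sphere E y a|%:R)%R%:R) <=
  Ex (fun E => (reach (adj E) (2 * a)%N.+1 x y)%:R) + (Ex (fun=> 1) +
  Ex (fun E => ((s <= #|sphere E x a|%:R) && (s <= #|sphere E y a|%:R) &&
     ~~ reach (adj E) (2 * a)%N.+1 x y)%R%:R)).
  by rewrite expect_cst; lra.
rewrite -!expectD; apply: Ule => E; case: (reach _ _ _ _);
  case: (s <= #|sphere E x a|%:R); case: (s <= #|sphere E y a|%:R) => /=; lra.
Qed.

Definition close_pairs (L : nat) E : R :=
  \sum_x \sum_y (reach (adj E) L x y)%:R.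

(** A pair x, y that is close only thanks to uv has one point within i of one end of uv and the
    other within j of the other end, with i + j < L. *)
Lemma close_pairs_edge L u v E : u != v ->
  `|close_pairs L ([set u; v] |: E) - close_pairs L (E :\ [set u; v])| <=
  \sum_(ij : 'I_L * 'I_L) (ij.1 + ij.2 < L)%N%:R *
     (#|ball E u ij.1|%:R * #|ball E v ij.2|%:R +
      #|ball E v ij.1|%:R * #|ball E u ij.2|%:R).
Proof.
move=> uv; set E1 := _ |: E; set E0 := E :\ _.
have E01 : subrel (adj E0) (adj E1).
  by move=> w z; rewrite /adj /= !inE => /and3P[-> _ ->]; rewrite orbT.
rewrite ger0_norm; last first.
  rewrite subr_ge0; apply: ler_sum => x _; apply: ler_sum => y _.
  by case r0: (reach (adj E0) L x y) => //; rewrite (sub_reach E01 r0).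
apply: (@le_trans _ _ (\sum_x \sum_y \sum_(ij : 'I_L * 'I_L) (ij.1 + ij.2 < L)%N%:R *
    ((x \in ball E u ij.1)%:R * (y \in ball E v ij.2)%:R +
     (x \in ball E v ij.1)%:R * (y \in ball E u ij.2)%:R))).
  rewrite /close_pairs -sumrB; apply: ler_sum => x _; rewrite -sumrB; apply: ler_sum => y _.
  set F := (F in \sum_i F i); have F0 ij : 0 <= F ij.
    by rewrite /F mulr_ge0 // addr_ge0 // mulr_ge0.
  have S0 : 0 <= \sum_ij F ij by apply: sumr_ge0.
  case: (boolP (reach (adj E1) L x y)) => [r1|_]; last first.
    by apply: le_trans S0; rewrite sub0r oppr_le0.
  case: (boolP (reach (adj E0) L x y)) => [_|r0]; first by rewrite subrr.
  rewrite subr0; case: (reach_add_edge r1) => [h|[i [j [ij h]]]].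
    by rewrite h in r0.
  have iL : (i < L)%N := leq_ltn_trans (leq_addr j i) ij.
  have jL : (j < L)%N := leq_ltn_trans (leq_addl i j) ij.
  rewrite (bigD1 (Ordinal iL, Ordinal jL)) //=; set T := \sum_(_ | _) _.
  have T0 : 0 <= T by apply: sumr_ge0.
  (* The two pieces avoid uv, so they lie in balls of [E] itself, whose moments are known. *)
  have inE0 w z k : reach (adj E0) k z w -> w \in ball E z k.
    move=> hk; rewrite in_ball; apply: sub_reach hk => w1 w2.
    by rewrite /adj /= !inE => /and3P[-> _ ->].
  have inE0' w z k : reach (adj E0) k w z -> w \in ball E z k.
    by rewrite reach_sym; [exact: inE0 | exact: adj_sym].
  rewrite /F /= ij mul1r; case: h => -[/inE0' -> /inE0 ->]; rewrite mulr1n mul1r.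
    by rewrite -addrA lerDl addr_ge0 // mulr_ge0.
  by rewrite addrAC lerDr addr_ge0 // mulr_ge0.
have card1 (A : {set 'I_n}) : #|A|%:R = \sum_x (x \in A)%:R :> R.
  by rewrite -sum1_card natr_sum big_mkcond; apply: eq_bigr => x _; case: (x \in A).
under eq_bigr do rewrite exchange_big /=.
rewrite exchange_big /=; apply: ler_sum => ij _.
under eq_bigr do rewrite -mulr_sumr big_split /= -!mulr_sumr -!card1.
by rewrite -mulr_sumr big_split /= -!mulr_suml -!card1.
Qed.

(** The two balls are dependent; once normalised by their typical sizes, u^2 v^2 <= u^4 + v^4
    reduces to fourth moments of single balls. *)
Lemma expect_balls22 x y i j L : 2 <= lam -> (i + j < L)%N ->
  Ex (fun E => (#|ball E x i|%:R * #|ball E y j|%:R) ^+ 2) <=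
  4 * 24 ^+ 4 * L%:R ^+ 5 * lam ^+ L ^+ 2.
Proof.
move=> lam2 ijL; have l0 : 0 < lam by lra.
have li : 0 < lam ^+ i by rewrite exprn_gt0.
have lj : 0 < lam ^+ j by rewrite exprn_gt0.
have bnd z k : (k < L)%N -> Ex (fun E => (#|ball E z k|%:R / lam ^+ k) ^+ 4) <=
    2 * 24 ^+ 4 * L%:R ^+ 5.
  move=> kL; have lk : 0 < lam ^+ k by rewrite exprn_gt0.
  have -> : Ex (fun E => (#|ball E z k|%:R / lam ^+ k) ^+ 4) =
      Ex (fun E => (lam ^+ k ^+ 4)^-1 * #|ball E z k|%:R ^+ 4).
    by apply: eq_expect => E _; rewrite mulrC exprMn exprVn.
  rewrite expectZ ler_pdivrMl ?exprn_gt0 //.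
  apply: le_trans (expect_ball4 p_ge0 p_le1 z k lam2) _.
  rewrite -/lam [leRHS]mulrC; apply: ler_wpM2r; first by rewrite exprn_ge0 // ltW.
  apply: ler_wpM2l; first by rewrite mulr_ge0 // exprn_ge0.
  by rewrite lerXn2r ?nnegrE // ler_nat.
apply: (@le_trans _ _ (Ex (fun E => lam ^+ (i + j) ^+ 2 *
   ((#|ball E x i|%:R / lam ^+ i) ^+ 4 + (#|ball E y j|%:R / lam ^+ j) ^+ 4)))).
  apply: Ule => E; set b := #|_|%:R; set c := #|_|%:R.
  have -> : (b * c) ^+ 2 = lam ^+ (i + j) ^+ 2 * ((b / lam ^+ i) ^+ 2 * (c / lam ^+ j) ^+ 2).
    by rewrite exprD; field; rewrite !gt_eqF.
  rewrite ler_wpM2l ?sqr_ge0 //; move: (b / _) (c / _) => u v.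
  have := sqr_ge0 (u ^+ 2 - v ^+ 2); have := sqr_ge0 (u ^+ 2); have := sqr_ge0 (v ^+ 2).
  lra.
rewrite expectZ expectD.
have iL : (i < L)%N := leq_ltn_trans (leq_addr j i) ijL.
have jL : (j < L)%N := leq_ltn_trans (leq_addl i j) ijL.
have h := lerD (bnd x i iL) (bnd y j jL).
apply: le_trans (ler_wpM2l (sqr_ge0 _) h) _.
have -> : 2 * 24 ^+ 4 * L%:R ^+ 5 + 2 * 24 ^+ 4 * L%:R ^+ 5 = 4 * 24 ^+ 4 * L%:R ^+ 5 :> R.
  ring.
rewrite mulrC ler_wpM2l ?mulr_ge0 ?exprn_ge0 // lerXn2r ?nnegrE ?exprn_ge0 ?(ltW l0) //.
by rewrite ler_weXn2l ?(ltnW ijL) //; lra.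
Qed.

(** The exponent 9 consists of 5 from the balls, 2 from Cauchy-Schwarz over the radii and 2 from the
    number of terms. *)
Lemma expect_close_pairs_edge L u v : 2 <= lam -> u != v ->
  Ex (fun E => (close_pairs L ([set u; v] |: E) - close_pairs L (E :\ [set u; v])) ^+ 2) <=
  16 * 24 ^+ 4 * L%:R ^+ 9 * lam ^+ L ^+ 2.
Proof.
move=> lam2 uv; have l0 : 0 <= lam by lra.
pose t E (ij : 'I_L * 'I_L) : R := (ij.1 + ij.2 < L)%N%:R *
     (#|ball E u ij.1|%:R * #|ball E v ij.2|%:R +
      #|ball E v ij.1|%:R * #|ball E u ij.2|%:R).
apply: (@le_trans _ _ (Ex (fun E => (L ^ 2)%:R * \sum_ij t E ij ^+ 2))).
  apply: Ule => E; rewrite -real_normK ?num_real //.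
  apply: (@le_trans _ _ ((\sum_ij t E ij) ^+ 2)).
    rewrite lerXn2r ?nnegrE //; last exact: close_pairs_edge.
    by apply: sumr_ge0 => ij _; rewrite mulr_ge0 // addr_ge0 // mulr_ge0.
  by apply: le_trans (sqr_sum_le _) _; rewrite card_prod card_ord mulnn.
rewrite expectZ expect_sum.
apply: (@le_trans _ _ ((L ^ 2)%:R * \sum_(ij : 'I_L * 'I_L)
    (16 * 24 ^+ 4 * L%:R ^+ 5 * lam ^+ L ^+ 2))); last first.
  rewrite sumr_const card_prod card_ord mulnn -[_ *+ _]mulr_natl natrX.
  by rewrite le_eqVlt; apply/orP; left; apply/eqP; ring.
rewrite ler_wpM2l //; apply: ler_sum => -[i j] _.
have [ij|ij] := boolP (i + j < L)%N; last first.
  rewrite (_ : Ex _ = 0) ?mulr_ge0 ?exprn_ge0 //.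
  rewrite -[RHS](expect_cst p (enum (vertex_pairs n))).
  by apply: eq_expect => E _; rewrite /t /= (negbTE ij) mul0r expr0n.
apply: (@le_trans _ _ (Ex (fun E => 2 * ((#|ball E u i|%:R * #|ball E v j|%:R) ^+ 2 +
   (#|ball E v i|%:R * #|ball E u j|%:R) ^+ 2)))).
  apply: Ule => E; rewrite /t /= ij mul1r.
  move: (#|ball E u i|%:R * _) (#|ball E v i|%:R * _) => a b.
  have := sqr_ge0 (a - b); lra.
rewrite expectZ expectD.
have h1 := expect_balls22 u v lam2 ij; have h2 := expect_balls22 v u lam2 ij.
lra.
Qed.

(** Efron-Stein, with at most n^2 pairs each weighted by p = lam / n. *)
Lemma variance_close_pairs L : 2 <= lam ->
  Ex (fun E => close_pairs L E ^+ 2) - Ex (close_pairs L) ^+ 2 <=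
  n%:R * lam * (16 * 24 ^+ 4 * L%:R ^+ 9 * lam ^+ L ^+ 2).
Proof.
move=> lam2; apply: le_trans (efron_stein p_ge0 p_le1 _ (enum_uniq _)) _.
set M := _ * lam ^+ L ^+ 2; have M0 : 0 <= M.
  by rewrite /M !mulr_ge0 ?exprn_ge0 //; lra.
apply: (@le_trans _ _ (\sum_(e <- enum (vertex_pairs n)) p * M)).
  rewrite !big_seq; apply: ler_sum => e; rewrite mem_enum inE => /cards2P[u [v [uv ->]]].
  by rewrite ler_wpM2l // expect_close_pairs_edge.
rewrite big_const_seq count_predT -cardE iter_addr_0 -[_ *+ _]mulr_natl [leLHS]mulrA.
apply: ler_wpM2r => //; rewrite /lam mulrA; apply: ler_wpM2r => //.
rewrite -natrM ler_nat.
rewrite (leq_trans (subset_leq_card _ : _ <= #|spans [set: 'I_n] [set: 'I_n]|)%N) //.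
  apply/subsetP=> e; rewrite inE => /cards2P[u [v [uv ->]]].
  by apply/imset2P; exists u v; rewrite ?inE.
by rewrite (leq_trans (card_spans _ _)) // cardsT card_ord.
Qed.

Lemma chebyshev (X : {set {set 'I_n}} -> R) (t : R) : 0 < t ->
  Ex (fun E => (X E <= Ex X - t)%R%:R) <=
  (Ex (fun E => X E ^+ 2) - Ex X ^+ 2) / t ^+ 2.
Proof.
move=> t0; set m := Ex X.
have -> : Ex (fun E => X E ^+ 2) - m ^+ 2 = Ex (fun E => (X E - m) ^+ 2).
  have -> : Ex (fun E => (X E - m) ^+ 2) = Ex (fun E => X E ^+ 2 + (- 2 * m * X E + m ^+ 2)).
    by apply: eq_expect => E _; ring.
  by rewrite !expectD expectZ expect_cst -/m; ring.
apply: le_trans (markov (fun E => sqr_ge0 _) (exprn_gt0 2 t0)).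
apply: Ule => E; case: (lerP (X E) (m - t)) => [h|_] /=; last exact: ler0n.
case: (lerP (t ^+ 2) ((X E - m) ^+ 2)) => // h2.
have : 0 <= (m - t - X E) * (m + t - X E) by apply: mulr_ge0; lra.
nra.
Qed.

(** Some w has distances to x, y, z of sum at most [K]; explicit radii allow a union bound. *)
Definition bad_triple E K (x y z : 'I_n) : bool :=
  [exists w, exists ijk : 'I_K.+1 * 'I_K.+1 * 'I_K.+1,
    [&& (ijk.1.1 + ijk.1.2 + ijk.2 <= K)%N, x \in ball E w ijk.1.1,
        y \in ball E w ijk.1.2 & z \in ball E w ijk.2]].

(** Union bound over w and the radii. The three balls share their center, and u v z <= 3 + u^4 + v^4
    + z^4 for the normalised sizes again leaves fourth moments. *)
Lemma expect_bad_triples K : 2 <= lam ->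
  Ex (fun E => \sum_x \sum_y \sum_z (bad_triple E K x y z)%:R) <=
  n%:R * (K.+1%:R ^+ 3 * (lam ^+ K * (9 * 24 ^+ 4 * K.+1%:R ^+ 5))).
Proof.
move=> lam2; have l0 : 0 < lam by lra.
have card1 (A : {set 'I_n}) : #|A|%:R = \sum_x (x \in A)%:R :> R.
  by rewrite -sum1_card natr_sum big_mkcond; apply: eq_bigr => x _; case: (x \in A).
pose t E w (ijk : 'I_K.+1 * 'I_K.+1 * 'I_K.+1) : R := (ijk.1.1 + ijk.1.2 + ijk.2 <= K)%N%:R *
   (#|ball E w ijk.1.1|%:R * (#|ball E w ijk.1.2|%:R * #|ball E w ijk.2|%:R)).
apply: (@le_trans _ _ (Ex (fun E => \sum_w \sum_ijk t E w ijk))).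
  apply: Ule => E.
  have -> : \sum_w \sum_ijk t E w ijk = \sum_x \sum_y \sum_z \sum_w \sum_(ijk : 'I_K.+1 * 'I_K.+1 * 'I_K.+1)
     (ijk.1.1 + ijk.1.2 + ijk.2 <= K)%N%:R * ((x \in ball E w ijk.1.1)%:R *
      ((y \in ball E w ijk.1.2)%:R * (z \in ball E w ijk.2)%:R)).
    apply/esym.
    under eq_bigr do under eq_bigr do rewrite exchange_big /=.
    under eq_bigr do rewrite exchange_big /=.
    rewrite exchange_big /=; apply: eq_bigr => w _.
    under eq_bigr do under eq_bigr do rewrite exchange_big /=.
    under eq_bigr do rewrite exchange_big /=.
    rewrite exchange_big /=; apply: eq_bigr => ijk _.
    under eq_bigr do under eq_bigr do rewrite -!mulr_sumr -card1.
    under eq_bigr do rewrite -!mulr_sumr -mulr_suml -card1.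
    by rewrite -!mulr_sumr -mulr_suml -card1.
  apply: ler_sum => x _; apply: ler_sum => y _; apply: ler_sum => z _.
  have pos w (ijk : 'I_K.+1 * 'I_K.+1 * 'I_K.+1) : 0 <= (ijk.1.1 + ijk.1.2 + ijk.2 <= K)%N%:R * ((x \in ball E w ijk.1.1)%:R *
      ((y \in ball E w ijk.1.2)%:R * (z \in ball E w ijk.2)%:R)) :> R.
    by rewrite !mulr_ge0.
  case: (boolP (bad_triple E K x y z)) => [/existsP[w /existsP[ijk]]|_]; last first.
    by apply: sumr_ge0 => w _; apply: sumr_ge0 => ijk _; exact: pos.
  case/and4P=> h1 h2 h3 h4.
  rewrite (bigD1 w) //= (bigD1 ijk) //= h1 h2 h3 h4 !mulr1 -addrA lerDl.
  apply: addr_ge0; first by apply: sumr_ge0 => ijk' _; exact: pos.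
  by apply: sumr_ge0 => w' _; apply: sumr_ge0 => ijk' _; exact: pos.
rewrite expect_sum.
have -> : n%:R * (K.+1%:R ^+ 3 * (lam ^+ K * (9 * 24 ^+ 4 * K.+1%:R ^+ 5))) =
  \sum_(w : 'I_n) \sum_(ijk : 'I_K.+1 * 'I_K.+1 * 'I_K.+1) lam ^+ K * (9 * 24 ^+ 4 * K.+1%:R ^+ 5).
  set c := lam ^+ K * _; rewrite !sumr_const !card_prod !card_ord -mulrnA.
  by rewrite -[c *+ _]mulr_natl !natrM; ring.
apply: ler_sum => w _; rewrite expect_sum; apply: ler_sum => -[[i j] k] _.
have [ijk|ijk] := boolP (i + j + k <= K)%N; last first.
  rewrite (_ : Ex _ = 0) ?mulr_ge0 ?exprn_ge0 ?(ltW l0) //.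
  rewrite -[RHS](expect_cst p (enum (vertex_pairs n))).
  by apply: eq_expect => E _; rewrite /t /= (negbTE ijk) mul0r.
have bnd (q : 'I_K.+1) : Ex (fun E => (#|ball E w q|%:R / lam ^+ q) ^+ 4) <=
    2 * 24 ^+ 4 * K.+1%:R ^+ 5.
  have lk : 0 < lam ^+ q by rewrite exprn_gt0.
  have -> : Ex (fun E => (#|ball E w q|%:R / lam ^+ q) ^+ 4) =
      Ex (fun E => (lam ^+ q ^+ 4)^-1 * #|ball E w q|%:R ^+ 4).
    by apply: eq_expect => E _; rewrite mulrC exprMn exprVn.
  rewrite expectZ ler_pdivrMl ?exprn_gt0 //.
  apply: le_trans (expect_ball4 p_ge0 p_le1 w q lam2) _.
  rewrite -/lam [leRHS]mulrC; apply: ler_wpM2r; first by rewrite exprn_ge0 // ltW.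
  apply: ler_wpM2l; first by rewrite mulr_ge0 // exprn_ge0.
  by rewrite lerXn2r ?nnegrE // ler_nat.
apply: (@le_trans _ _ (Ex (fun E => lam ^+ K * (3 +
   ((#|ball E w i|%:R / lam ^+ i) ^+ 4 + ((#|ball E w j|%:R / lam ^+ j) ^+ 4 +
    (#|ball E w k|%:R / lam ^+ k) ^+ 4)))))).
  apply: Ule => E; rewrite /t /= ijk mul1r.
  set b := #|ball E w i|%:R; set c := #|ball E w j|%:R; set d := #|ball E w k|%:R.
  have -> : b * (c * d) = lam ^+ (i + j + k) * ((b / lam ^+ i) * ((c / lam ^+ j) * (d / lam ^+ k))).
    by rewrite !exprD; field; rewrite !gt_eqF ?exprn_gt0.
  have pos q e : 0 <= #|ball E w q|%:R / lam ^+ e.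
    by rewrite divr_ge0 // exprn_ge0 // ltW.
  apply: ler_pM.
  - by rewrite exprn_ge0 // ltW.
  - by apply: mulr_ge0; [exact: pos | apply: mulr_ge0; exact: pos].
  - by rewrite ler_weXn2l //; lra.
  move: (b / _) (c / _) (d / _) => u v z.
  have := sqr_ge0 (u - v * z); have := sqr_ge0 (v ^+ 2 - z ^+ 2).
  have := sqr_ge0 (u ^+ 2 - 1); have := sqr_ge0 (u ^+ 2).
  have := sqr_ge0 (v ^+ 2); have := sqr_ge0 (z ^+ 2).
  lra.
rewrite expectZ ler_wpM2l ?exprn_ge0 ?(ltW l0) // !expectD expect_cst.
have K1 : 1 <= K.+1%:R ^+ 5 :> R by rewrite exprn_ege1 // ler1n.
have hi := bnd i; have hj := bnd j; have hk := bnd k.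
by move: (K.+1%:R ^+ 5) K1 hi hj hk => c c1; lra.
Qed.

End Estimates.

(** * Triangles in the largest component *)

Section Triangles.
Variables (T : finType) (e : rel T).
Hypotheses (e_sym : symmetric e) (e_conn : forall x y, connect e x y).
Implicit Types (x y z : T).

Lemma near_setP (A : {set T}) d u :
  reflect (exists2 v, v \in A & reach e d u v) (near_set e A d u).
Proof.
apply: (iffP existsP) => [[v /andP[vA uv]]|[v vA uv]]; exists v => //.
  by apply: reach_leq uv _ => //; exact: reach_dist.
by rewrite vA dist_le_reach.
Qed.

(** A witness below the cut-off ensures that [least] is a true minimum and not its default value. *)
Lemma least_leq (P : pred nat) d : (exists2 k, (k < #|T|)%N & P k) ->
  (least T P <= d)%N -> exists2 k, (k <= d)%N & P k.
Proof.
case=> k kT Pk ld.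
have hP : has P (iota 0 #|T|) by apply/hasP; exists k; rewrite ?mem_iota.
exists (least T P) => //.
have := nth_find 0%N hP; rewrite nth_iota //.
by have := hP; rewrite has_find size_iota.
Qed.

Lemma diam_lt (A : {set T}) (x : T) : (diam e A < #|T|)%N.
Proof.
have T0 : (0 < #|T|)%N by apply/card_gt0P; exists x.
rewrite -(prednK T0) ltnS; apply/bigmax_leqP => u _; apply/bigmax_leqP => v _.
by rewrite -ltnS prednK //; case: (connect_dist (e_conn u v)).
Qed.

Lemma diam_ge (A : {set T}) u v : u \in A -> v \in A -> (dist e u v <= diam e A)%N.
Proof.
move=> uA vA; apply: leq_trans (@leq_bigmax_cond _ (mem A) _ u uA) => /=.
exact: (@leq_bigmax_cond _ (mem A) (fun v => dist e u v)).
Qed.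

(** Common consequence of a small [minsize] and a small [slim]; only distances from x' matter
    afterwards. *)
Definition center d (Sxy Syz Szx : {set T}) := exists x' y' z',
  [/\ x' \in Syz, y' \in Szx, z' \in Sxy, reach e d x' y' & reach e d x' z'].

Lemma minsize_center d (Sxy Syz Szx : {set T}) x y z :
  x \in Sxy -> y \in Syz -> z \in Szx ->
  (minsize e Sxy Syz Szx <= d)%N -> center d Sxy Syz Szx.
Proof.
move=> xS yS zS /least_leq; case.
  exists (diam e [set y; z; x]); first exact: diam_lt.
  apply/existsP; exists y; rewrite yS; apply/existsP; exists z; rewrite zS.
  by apply/existsP; exists x; rewrite xS /=.
move=> k kd /existsP[x' /andP[x'S /existsP[y' /andP[y'S /existsP[z' /andP[z'S /eqP dk]]]]]].
exists x', y', z'; split=> //.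
  apply: reach_leq (reach_dist (e_conn x' y')).
  by rewrite (leq_trans (@diam_ge [set x'; y'; z'] x' y' _ _)) ?dk // !inE eqxx ?orbT.
apply: reach_leq (reach_dist (e_conn x' z')).
by rewrite (leq_trans (@diam_ge [set x'; y'; z'] x' z' _ _)) ?dk // !inE eqxx ?orbT.
Qed.

(** Discrete connectedness: stop at the first vertex after the start that satisfies Q. The case u =
    v covers the trivial path. *)
Lemma path_crossing (P Q : pred T) x p : path e x p -> P x -> Q (last x p) ->
  all (predU P Q) p -> exists u v, [/\ u \in x :: p, u = v \/ e u v, P u & Q v].
Proof.
elim: p x => [|w p IH] x /=; first by move=> _ Px Qx _; exists x, x; split; rewrite ?inE ?eqxx //; left.
case/andP=> xw pp Px Ql /andP[PQw PQ].
have [Qw|nQw] := boolP (Q w).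
  by exists x, w; split; rewrite ?inE ?eqxx //; right.
have Pw : P w by case/orP: PQw => //= Qw; rewrite Qw in nQw.
have [u [v [up uv Pu Qv]]] := IH w pp Pw Ql PQ.
by exists u, v; split=> //; rewrite inE up orbT.
Qed.

(* The side [x, y] starts on [z, x] and ends on [y, z]; somewhere in between it
   passes from being close to the former to being close to the latter. *)
Lemma slim_center d x y z p q r :
  p \in geodesics e x y -> q \in geodesics e y z -> r \in geodesics e z x ->
  (slim e (vertices x p) (vertices y q) (vertices z r) <= d)%N ->
  center d.*2.+1 (vertices x p) (vertices y q) (vertices z r).
Proof.
move=> /geodesic_path[pp lp] /geodesic_path[pq lq] /geodesic_path[pr lr] /least_leq; case.
  have T0 : (0 < #|T|)%N by apply/card_gt0P; exists x.
  exists #|T|.-1; first by rewrite prednK.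
  have near (A : {set T}) w u : w \in A -> near_set e A #|T|.-1 u.
    move=> wA; apply/existsP; exists w; rewrite wA /= -ltnS prednK //.
    by case: (connect_dist (e_conn u w)).
  apply/and3P; split; apply/forall_inP => u _.
  - by apply: (near _ y); rewrite !inE eqxx.
  - by apply: (near _ z); rewrite !inE eqxx.
  - by apply: (near _ x); rewrite !inE eqxx.
move=> k kd /and3P[/forall_inP nxy _ _].
have [u [v [uS uv nu nv]]] : exists u v, [/\ u \in x :: p, u = v \/ e u v,
   near_set e (vertices z r) d u & near_set e (vertices y q) d v].
  apply: path_crossing => //.
  - by apply/near_setP; exists x; [rewrite inE -[X in X \in _]lr mem_last | exact: reach_refl].
  - by apply/near_setP; exists y; [rewrite inE mem_head | rewrite lp; exact: reach_refl].
  apply/allP=> w wp; have : w \in vertices x p by rewrite !inE wp orbT.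
  move/nxy/near_setP=> [a]; rewrite inE => /orP[] aS wa; apply/orP; [right|left];
    by apply/near_setP; exists a => //; exact: reach_leq wa.
have [y' y'S uy'] := near_setP _ _ _ nu; have [x' x'S vx'] := near_setP _ _ _ nv.
have ux' : reach e d.+1 u x'.
  case: uv => [->|uv]; first exact: reach_leq vx'.
  by rewrite -add1n; apply: reach_trans vx'; exact: reach_edge.
rewrite reach_sym // in ux'.
exists x', y', u; split=> //; first by rewrite inE.
  by apply: reach_leq (reach_trans ux' uy'); rewrite addSn addnn.
by apply: reach_leq ux'; rewrite ltnS -addnn leq_addr.
Qed.

(* Summing the detours through x' of the three sides counts each of the
   distances from x' to the corners twice. *)
Lemma center_radii d L x y z p q r :
  p \in geodesics e x y -> q \in geodesics e y z -> r \in geodesics e z x ->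
  reach e L x y -> reach e L y z -> reach e L z x ->
  center d (vertices x p) (vertices y q) (vertices z r) ->
  exists w i j k, [/\ (2 * (i + j + k) <= 3 * L + 4 * d)%N,
    reach e i w x, reach e j w y & reach e k w z].
Proof.
move=> gp gq gr /dist_le_reach dxy /dist_le_reach dyz /dist_le_reach dzx.
case=> w [y' [z' [wS y'S z'S wy' wz']]].
have [i1 [j1 [yw w_z s1]]] := geodesic_split gq wS.
have [i2 [j2 [xz' z'y s2]]] := geodesic_split gp z'S.
have [i3 [j3 [zy' y'x s3]]] := geodesic_split gr y'S.
have wx1 := reach_trans wy' y'x.
have wx2 : reach e (d + i2) w x by apply: reach_trans wz' _; rewrite reach_sym.
have wy1 : reach e i1 w y by rewrite reach_sym.
have wy2 := reach_trans wz' z'y.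
have wz2 : reach e (d + i3) w z by apply: reach_trans wy' _; rewrite reach_sym.
(* Each corner is reached from w in two ways, and each minimum is at most half the sum of the two
   lengths. The six lengths add up to the three sides plus 4 d. *)
exists w, (minn (d + j3) (d + i2)), (minn i1 (d + j2)), (minn j1 (d + i3)); split.
- rewrite -s1 in dyz; rewrite -s2 in dxy; rewrite -s3 in dzx.
  clear -dxy dyz dzx; lia.
- by rewrite /minn; case: ifP.
- by rewrite /minn; case: ifP.
- by rewrite /minn; case: ifP.
Qed.

End Triangles.

Section Expectation.
Variables (R : realFieldType) (T : finType) (e : rel T).
Hypothesis e_conn : forall x y, connect e x y.

Lemma average_ge (U : finType) (A : {set U}) (F : U -> R) c :
  A != set0 -> (forall u, u \in A -> c <= F u) -> c <= average A F.
Proof.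
move=> A0 cF; rewrite /average ler_pdivlMr ?ltr0n ?card_gt0 //.
rewrite mulr_natr -sumr_const; exact: ler_sum.
Qed.

(** Connectedness makes every set of geodesics nonempty, so that averages over sides preserve the
    lower bound [c]. *)
Lemma triangle_expectation_ge (F : {set T} -> {set T} -> {set T} -> nat) (c : nat)
  (good : T -> T -> T -> bool) :
  (forall x y z p q r, good x y z ->
     p \in geodesics e x y -> q \in geodesics e y z -> r \in geodesics e z x ->
     (c <= F (vertices x p) (vertices y q) (vertices z r))%N) ->
  c%:R * (\sum_x \sum_y \sum_z (good x y z)%:R) / #|T|%:R ^+ 3 <=
  triangle_expectation R e F.
Proof.
move=> cF; rewrite /triangle_expectation.
have geo x y : geodesics e x y != set0 by case: (connect_dist (e_conn x y)).
have ext (G H : T -> R) : (forall x, G x <= H x) ->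
    (\sum_x G x) / #|T|%:R <= average [set: T] H.
  move=> GH; rewrite /average cardsT ler_wpM2r ?invr_ge0 //.
  rewrite [leRHS](eq_bigl xpredT) => [|x]; last by rewrite inE.
  exact: ler_sum.
have -> : c%:R * (\sum_x \sum_y \sum_z (good x y z)%:R) / #|T|%:R ^+ 3 =
   (\sum_x (\sum_y (\sum_z c%:R * (good x y z)%:R) / #|T|%:R) / #|T|%:R) / #|T|%:R :> R.
  have cube (X t : R) : X / t ^+ 3 = X / t / t / t.
    by rewrite -!mulrA -!invfM; congr (_ / _); ring.
  rewrite cube; congr (_ / _); rewrite mulr_sumr !mulr_suml; apply: eq_bigr => x _.
  congr (_ / _); rewrite mulr_sumr mulr_suml; apply: eq_bigr => y _.
  by congr (_ / _); rewrite mulr_sumr.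
apply: (ext _ _) => x; apply: (ext _ _) => y; apply: (ext _ _) => z.
apply: average_ge => // p gp; apply: average_ge => // q gq; apply: average_ge => // r gr.
case g : (good x y z); last by rewrite mulr0.
by rewrite mulr1 ler_nat; apply: cF g gp gq gr.
Qed.

End Expectation.

Lemma sum_subtype (R : nmodType) (T : finType) (C : {set T}) (F : T -> R) :
  \sum_(x : {x : T | x \in C}) F (val x) = \sum_(x in C) F x.
Proof. by rewrite (big_sub (mem C)). Qed.

(** * Proportion of good triples in the largest component *)

Section LargestComponent.
Variables (R : realFieldType) (n : nat) (E : {set {set 'I_n}}) (C : {set 'I_n}).
Hypothesis C_largest : is_largest_component (adj E) C.
Implicit Types (x y z : 'I_n).

Let nu : R := n%:R.
Notation H := (reach (adj E)).

Lemma component_closed x y : x \in C -> connect (adj E) x y -> y \in C.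
Proof.
case/andP: C_largest => /imsetP[x0 _ ->] _; rewrite !inE; exact: connect_trans.
Qed.

Lemma component_connect x y : x \in C -> y \in C -> connect (adj E) x y.
Proof.
case/andP: C_largest => /imsetP[x0 _ ->] _; rewrite !inE => h.
by apply: connect_trans; rewrite (sym_connect_sym (@adj_sym _ E)).
Qed.

Definition degree L x : R := \sum_y (H L x y)%:R.

(** The component of x is disjoint from C and no larger than it. *)
Lemma degree_le L x : x \notin C -> degree L x <= nu / 2.
Proof.
move=> xC; pose D := [set y | connect (adj E) x y].
have DC : (#|D| <= #|C|)%N.
  case/andP: C_largest => _ /forall_inP; apply; apply/imsetP; by exists x.
have dis : C :&: D = set0.
  apply/setP=> y; rewrite !inE; apply/negP => /andP[yC xy]; case/negP: xC.
  by apply: component_closed yC _; rewrite (sym_connect_sym (@adj_sym _ E)).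
have cardCD : (#|C| + #|D| <= n)%N.
  have := cardsUI C D; rewrite dis cards0 addn0 => <-.
  by rewrite -[leqRHS](card_ord n) max_card.
have dD : degree L x <= #|D|%:R.
  rewrite /degree -sum1_card natr_sum [leRHS]big_mkcond; apply: ler_sum => y _.
  rewrite inE; case h: (H L x y); first by rewrite (reach_connect h).
  by case: ifP.
apply: le_trans dD _; rewrite ler_pdivlMr // mulr_natr -mulrnA ler_nat.
by clear -DC cardCD; lia.
Qed.

(** Two close vertices have at least deg x + deg y - n common close vertices; summing over close
    pairs gives the sum of 2 deg^2 - n deg. *)
Lemma triangles_ge L :
  nu * close_pairs R L E - nu ^+ 3 / 2 <=
  \sum_(x in C) \sum_(y in C) \sum_(z in C) [&& H L x y, H L y z & H L z x]%:R.
Proof.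
have Hsym x y : H L x y = H L y x by rewrite reach_sym //; exact: adj_sym.
have sumN : close_pairs R L E = \sum_x degree L x by [].
have step1 : nu * close_pairs R L E - nu ^+ 3 / 2 <=
    \sum_x \sum_y (H L x y)%:R * (degree L x + degree L y - nu).
  have -> : \sum_x \sum_y (H L x y)%:R * (degree L x + degree L y - nu) =
      \sum_x (2 * degree L x ^+ 2 - nu * degree L x).
    have -> : \sum_x \sum_y (H L x y)%:R * (degree L x + degree L y - nu) =
      \sum_x \sum_y (H L x y)%:R * (degree L x - nu) +
      \sum_x \sum_y (H L x y)%:R * degree L y.
      rewrite -big_split; apply: eq_bigr => x _ /=; rewrite -big_split.
      by apply: eq_bigr => y _ /=; ring.
    rewrite [X in _ + X]exchange_big /= -big_split; apply: eq_bigr => x _ /=.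
    rewrite -!mulr_suml -/(degree L x).
    have -> : \sum_y (H L y x)%:R = degree L x by apply: eq_bigr => y _; rewrite Hsym.
    ring.
  have -> : nu * close_pairs R L E - nu ^+ 3 / 2 =
      \sum_x (nu * degree L x - nu ^+ 2 / 2).
    rewrite sumrB -mulr_sumr -sumN sumr_const card_ord -[X in _ = _ - X]mulr_natl -/nu.
    by congr (_ - _); field.
  (* Tangent line at deg = n/2, in place of Cauchy-Schwarz. *)
  apply: ler_sum => x _; have := sqr_ge0 (degree L x - nu / 2); lra.
apply: le_trans step1 _; rewrite [leRHS]big_mkcond; apply: ler_sum => x _ /=.
(* Close pairs outside C have deg x + deg y <= n, so dropping them does not decrease the sum. *)
have [xC|xC] := boolP (x \in C); last first.
  rewrite -oppr_ge0 -sumrN; apply: sumr_ge0 => y _.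
  case h: (H L x y); last by rewrite mul0r oppr0.
  have yC : y \notin C.
    apply: contra xC => yC; apply: component_closed yC _.
    by apply: (@reach_connect _ _ L); rewrite Hsym.
  have := degree_le L xC; have := degree_le L yC; rewrite mul1r; lra.
rewrite [leRHS]big_mkcond; apply: ler_sum => y _ /=.
case h: (H L x y); last first.
  by rewrite mul0r; case: ifP => // _; apply: sumr_ge0.
have yC : y \in C by apply: component_closed xC (reach_connect h).
rewrite yC mul1r /= [leRHS]big_mkcond.
have -> : degree L x + degree L y - nu = \sum_z ((H L x z)%:R + (H L y z)%:R - 1).
  by rewrite sumrB big_split /= sumr_const card_ord.
apply: ler_sum => z _; rewrite (Hsym z x).
case h1: (H L x z); case h2: (H L y z); rewrite ?(component_closed xC (reach_connect h1)) /=;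
  try case: ifP => _; lra.
Qed.

Let T := {x : 'I_n | x \in C}.
Let eC : rel T := induced_subgraph (adj E) C.

Lemma induced_sym : symmetric eC.
Proof. by move=> x y; exact: adj_sym. Qed.

(** A walk starting in C stays in C. *)
Lemma reach_induced k (x y : T) : reach eC k x y = H k (val x) (val y).
Proof.
elim: k y => [//|k IH y]; apply/reachSP/reachSP => -[].
- by rewrite IH; left.
- by case=> u; rewrite IH => xu uy; right; exists (val u).
- by rewrite -IH; left.
case=> u xu uy; right.
have uC : u \in C by apply: component_closed (valP x) (reach_connect xu).
by exists (Sub u uC : T); rewrite ?IH.
Qed.

Lemma induced_conn (x y : T) : connect eC x y.
Proof.
have c : connect (adj E) (val x) (val y) by apply: component_connect; exact: valP.
apply: (@reach_connect _ _ (dist (adj E) (val x) (val y))).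
by rewrite reach_induced; exact: reach_dist.
Qed.

Definition good_triple L K x y z :=
  [&& H L x y, H L y z, H L z x & ~~ bad_triple E K x y z].

Lemma good_triple_center L K d (x y z : T) p q r :
  (3 * L + 4 * d <= 2 * K + 1)%N ->
  good_triple L K (val x) (val y) (val z) ->
  p \in geodesics eC x y -> q \in geodesics eC y z -> r \in geodesics eC z x ->
  ~ center eC d (vertices x p) (vertices y q) (vertices z r).
Proof.
move=> LK /and4P[]; rewrite -!reach_induced => xy yz zx nbad gp gq gr.
move/(center_radii induced_sym gp gq gr xy yz zx) => [w [i [j [k [s]]]]].
rewrite !reach_induced => wx wy wz.
have ijk : (i + j + k <= K)%N by clear -s LK; lia.
have iK : (i < K.+1)%N by clear -ijk; lia.
have jK : (j < K.+1)%N by clear -ijk; lia.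
have kK : (k < K.+1)%N by clear -ijk; lia.
case/negP: nbad; apply/existsP; exists (val w); apply/existsP.
exists (Ordinal iK, Ordinal jK, Ordinal kK) => /=.
by rewrite ijk !in_ball wx wy wz.
Qed.

(** Good triples are the triangles that are not bad; dividing by |C|^3 instead of n^3 only increases
    the proportion. *)
Lemma good_triples_ge L K (g : R) : 0 < nu -> 0 <= g ->
  g * nu ^+ 3 <= nu * close_pairs R L E - nu ^+ 3 / 2 -
    \sum_x \sum_y \sum_z (bad_triple E K x y z)%:R ->
  g <= (\sum_(x : T) \sum_(y : T) \sum_(z : T)
     (good_triple L K (val x) (val y) (val z))%:R) / #|{: T}|%:R ^+ 3.
Proof.
move=> nu0 g0 hg; set S := (X in _ <= X / _).
have hS : g * nu ^+ 3 <= S.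
  apply: (le_trans hg); rewrite lerBlDr; apply: (le_trans (triangles_ge L)).
  have -> : S = \sum_(x in C) \sum_(y in C) \sum_(z in C) (good_triple L K x y z)%:R.
    rewrite /S (sum_subtype C (fun x => \sum_(y : T) \sum_(z : T) (good_triple L K x (val y) (val z))%:R)).
    apply: eq_bigr => x _.
    rewrite (sum_subtype C (fun y => \sum_(z : T) (good_triple L K x y (val z))%:R)).
    apply: eq_bigr => y _.
    by rewrite (sum_subtype C (fun z => (good_triple L K x y z)%:R)).
  apply: (@le_trans _ _ (\sum_(x in C) \sum_(y in C) \sum_(z in C)
      ((good_triple L K x y z)%:R + (bad_triple E K x y z)%:R))).
    apply: ler_sum => x _; apply: ler_sum => y _; apply: ler_sum => z _.
    rewrite /good_triple; case: (H L x y); case: (H L y z); case: (H L z x) => //=;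
    by case: (bad_triple _ _ _ _ _); rewrite /= ?add0r ?addr0.
  under eq_bigr do under eq_bigr do rewrite big_split /=.
  under eq_bigr do rewrite big_split /=.
  rewrite big_split /= lerD2l.
  have sub (F : 'I_n -> R) : (forall x, 0 <= F x) -> \sum_(x in C) F x <= \sum_x F x.
    by move=> F0; rewrite [leRHS](bigID (mem C)) /= lerDl sumr_ge0.
  apply: le_trans (sub _ _); last by move=> x; do 2! apply: sumr_ge0 => ? _.
  apply: ler_sum => x _; apply: le_trans (sub _ _); last by move=> y; apply: sumr_ge0.
  by apply: ler_sum => y _; apply: sub.
have CT : #|{: T}| = #|C| by rewrite card_sig; apply: eq_card => x.
have Cn : #|{: T}|%:R <= nu by rewrite CT ler_nat -[leqRHS](card_ord n) max_card.
(* In the degenerate case the quotient is 0 by convention, and the hypothesis forces g <= 0. *)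
have [T0|T0] := eqVneq #|{: T}| 0%N.
  have S0 : S = 0.
    by rewrite /S big1 // => x; have := card0_eq T0 x; rewrite !inE.
  rewrite S0 in hS *; rewrite mul0r; have n3 : 0 < nu ^+ 3 by rewrite exprn_gt0.
  by rewrite -(pmulr_lle0 g n3).
rewrite ler_pdivlMr ?exprn_gt0 ?ltr0n ?lt0n //; apply: le_trans hS.
by rewrite ler_wpM2l // lerXn2r ?nnegrE // ltW.
Qed.

Lemma mean_ge L K d (g : R) : 0 < nu -> 0 <= g ->
  (3 * L + 4 * d <= 2 * K + 1)%N ->
  g * nu ^+ 3 <= nu * close_pairs R L E - nu ^+ 3 / 2 -
    \sum_x \sum_y \sum_z (bad_triple E K x y z)%:R ->
  d./2%:R * g <= mean_slim R eC /\ d./2%:R * g <= mean_minsize R eC.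
Proof.
move=> nu0 g0 LK hg; have hS := good_triples_ge nu0 g0 hg.
have := ler_wpM2l (ler0n R d./2) hS; rewrite mulrA => h; split.
  apply: le_trans h _.
  apply: (triangle_expectation_ge _ induced_conn) => x y z p q r gt gp gq gr.
  rewrite leqNgt; apply/negP => sl.
  (* The center then has parameter 2 (d/2 - 1) + 1, which is at most d. *)
  have sl' : (slim eC (vertices x p) (vertices y q) (vertices z r) <= d./2.-1)%N.
    by rewrite -ltnS; apply: leq_trans sl _; exact: leqSpred.
  have := slim_center induced_sym induced_conn gp gq gr sl'.
  apply: (good_triple_center _ gt gp gq gr); apply: leq_trans LK.
  rewrite leq_add2l leq_mul2l /=.
  have := odd_double_half d; clear -sl; lia.
apply: le_trans h _.
apply: (triangle_expectation_ge _ induced_conn) => x y z p q r gt gp gq gr.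
rewrite leqNgt; apply/negP => sl.
have sl' : (minsize eC (vertices x p) (vertices y q) (vertices z r) <= d)%N.
  apply: ltnW; apply: leq_trans sl _; have := odd_double_half d; clear; lia.
apply: (good_triple_center LK gt gp gq gr).
by apply: (@minsize_center _ _ induced_conn d _ _ _ x y z _ _ _ sl'); rewrite !inE eqxx.
Qed.

End LargestComponent.

(** * Quantitative bound *)

Section Sparse.
Variables (R : realFieldType) (n m : nat) (lambda : R).
Let nu : R := n%:R.
(** A 24th root of n up to a factor lambda, so that fractional powers of n become integral powers of
    [y]. *)
Let y := lambda ^+ m.
Let p := lambda / nu.
Hypothesis regime : [/\ 467%:R / 100%:R <= lambda, lambda <= nu, y ^+ 24 <= nu &
  nu < lambda ^+ 24 * y ^+ 24].
Notation Ex := (expect p (enum (vertex_pairs n))).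

Let l2 : 2 <= lambda. Proof. by case: regime => h _ _ _; lra. Qed.
Let l0 : 0 < lambda. Proof. by move: l2; lra. Qed.
Let nu0 : 0 < nu. Proof. by case: regime => _ h _ _; exact: lt_le_trans h. Qed.
Let p0 : 0 <= p. Proof. by rewrite divr_ge0 // ltW. Qed.
Let p1 : p <= 1. Proof. by rewrite ler_pdivrMr // mul1r; case: regime. Qed.
Let npE : n%:R * p = lambda. Proof. by rewrite /p -/nu; field; rewrite gt_eqF. Qed.
Let y1 : 1 <= y. Proof. by rewrite exprn_ege1 //; move: l2; lra. Qed.
Let y0 : 0 < y. Proof. exact: lt_le_trans y1. Qed.
Let lam2 : 2 <= n%:R * p. Proof. by rewrite npE. Qed.
Let le_expr k : (0 < k)%N -> y <= y ^+ k. Proof. by move=> k0; rewrite -{1}[y]expr1 ler_weXn2l. Qed.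

Let lamX k : lambda ^+ (k * m) = y ^+ k. Proof. by rewrite mulnC exprM. Qed.

(** With N close to 24 m and eps = 1/24, these are (7/12) N, (7/6) N and (7/4 + 2 eps) N up to
    constants, with [3 * L + 4 * m = 2 * K + 1]. *)
Let a := (14 * m)%N.
Let L := (2 * a)%N.+1.
Let K := (44 * m)%N.+1.

(** The second moment bound at s = z/200 and t = (39/50) / z, where 39/50 is close to the optimal
    400/509. Exceeding 3/4 is what makes more than half of the pairs close. *)
Lemma sphere_large x : 200 * (784 * lambda ^+ 2 * m.+1%:R ^+ 2) <= y ->
  77 / 100 <= Ex (fun E => (y ^+ 14 / 200 <= #|sphere E x a|%:R)%R%:R).
Proof.
move=> hy; set z := y ^+ 14; have z0 : 0 < z by rewrite exprn_gt0.
have zE : lambda ^+ a = z by rewrite /a lamX.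
have t0 : 0 <= 39 / 50 / z by rewrite !divr_ge0 // ltW.
have s0 : 0 <= z / 200 by rewrite divr_ge0 // ltW.
have := second_moment_bound p0 p1 (fun E => #|sphere E x a|%:R) s0 t0; apply: le_trans.
have := expect_sphere_ge p0 p1 x a lam2; have := expect_sphere2 p0 p1 x a.
rewrite npE zE exprS zE => /(_ _)/wrap[|]; first by move: l2; lra.
set s1 := Ex (fun E => #|sphere E x a|%:R).
set s2 := Ex (fun E => #|sphere E x a|%:R ^+ 2) => h2 h1.
set T := a%:R * (4 * a%:R + 2 * lambda).
have M1 : 1 <= m.+1%:R :> R by rewrite ler1n.
have T0 : 0 <= T by rewrite mulr_ge0 // addr_ge0 // mulr_ge0 // ltW.
have TM : T <= 784 * lambda * m.+1%:R ^+ 2.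
  have aM : a%:R <= 14 * m.+1%:R :> R by rewrite -natrM ler_nat /a leq_mul2l leqnSn.
  have -> : 784 * lambda * m.+1%:R ^+ 2 = (14 * m.+1%:R) * (56 * m.+1%:R * lambda).
    by ring.
  apply: ler_pM => //; first by rewrite addr_ge0 // mulr_ge0 // ltW.
  have : lambda <= m.+1%:R * lambda by rewrite ler_peMl // ltW.
  have : 2 * m.+1%:R <= m.+1%:R * lambda by rewrite mulrC ler_wpM2l.
  have : 0 <= m.+1%:R * lambda by rewrite mulr_ge0 // ltW.
  move: aM; lra.
(* As n >= y^10 z, the relative loss from collisions is polynomial in m divided by y^10. *)
have hT : 200 * (lambda * T) * z <= nu.
  case: regime => _ _ n_ge _; apply: le_trans n_ge; rewrite (_ : y ^+ 24 = y ^+ 10 * z); last by rewrite -exprD.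
  apply: ler_wpM2r; first exact: ltW.
  apply: le_trans (le_expr (isT : (0 < 10)%N)); apply: le_trans hy.
  rewrite ler_wpM2l // (_ : 784 * lambda ^+ 2 * _ = lambda * (784 * lambda * m.+1%:R ^+ 2)); last by ring.
  by rewrite ler_wpM2l // ltW.
have eta : p * (T * z ^+ 2) <= z / 200.
  have -> : p * (T * z ^+ 2) = (200 * (lambda * T) * z) * (z / 200) / nu.
    by rewrite /p; field; rewrite gt_eqF.
  by rewrite ler_pdivrMr // mulrC ler_wpM2l // divr_ge0 // ltW.
(* The bound 4.67 enters here: lambda / (lambda - 1) <= 509/400 means lambda >= 509/109. *)
have h2' : s2 <= 509 / 400 * z ^+ 2.
  have l1 : 0 < lambda - 1 by rewrite subr_gt0 (lt_le_trans _ l2) // ltr1n.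
  apply: le_trans h2 _; rewrite ler_pdivrMr //.
  have : 0 <= (509 / 400 * (lambda - 1) - lambda) * z ^+ 2.
    by rewrite mulr_ge0 ?sqr_ge0 //; case: regime => h _ _ _; lra.
  have z0' := ltW z0; lra.
have h1' : 199 / 200 * z <= s1.
  by move: eta h1; rewrite -/T; move: (p * _) => v; lra.
have -> : 2 * (39 / 50 / z) * s1 - (39 / 50 / z) ^+ 2 * s2 - 2 * (39 / 50 / z) * (z / 200)
  = 156 / 100 * (s1 / z) - 6084 / 10000 * (s2 / z ^+ 2) - 39 / 5000.
  by field; rewrite gt_eqF.
have : s2 / z ^+ 2 <= 509 / 400 by rewrite ler_pdivrMr ?exprn_gt0.
have : 199 / 200 <= s1 / z by rewrite ler_pdivlMr.
by move: (s1 / z) (s2 / z ^+ 2) => w v; lra.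
Qed.

(** 53/100 is 2 (77/100) - 1 - 1/100. Two large spheres span about y^28 pairs, against n of order
    y^24, so they fail to be joined with probability at most 1/100. *)
Lemma expect_close_pairs_ge :
  200 * (784 * lambda ^+ 2 * m.+1%:R ^+ 2) <= y -> 4 * 10 ^+ 6 * lambda ^+ 23 <= y ->
  53 / 100 * nu ^+ 2 <= Ex (close_pairs R L).
Proof.
move=> hy1 hy2; rewrite /close_pairs expect_sum.
have -> : 53 / 100 * nu ^+ 2 = \sum_(x : 'I_n) \sum_(y : 'I_n) (53 / 100).
  move: (53 / 100) => c; rewrite !sumr_const card_ord -mulrnA -[c *+ _]mulr_natl natrM.
  by rewrite -/nu; ring.
apply: ler_sum => x _; rewrite expect_sum; apply: ler_sum => x' _.
have s0 : 0 <= y ^+ 14 / 200 by rewrite divr_ge0 // exprn_ge0 // ltW.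
apply: (le_trans _ (expect_reach_ge p0 p1 x x' s0 (fun z => sphere_large z hy1))).
suff : (1 + p * (y ^+ 14 / 200) ^+ 2)^-1 <= 1 / 100.
  by move: (_^-1) => v; lra.
set q := p * _; have q99 : 99 <= q.
  have -> : q = lambda * y ^+ 28 / 200 ^+ 2 / nu.
    by rewrite /q /p; field; rewrite gt_eqF.
  rewrite ler_pdivlMr // ler_pdivlMr ?exprn_gt0 //.
  have h3 : 4 * 10 ^+ 6 * lambda ^+ 24 * y ^+ 24 <= lambda * y ^+ 28.
    have -> : lambda * y ^+ 28 = y ^+ 4 * (lambda * y ^+ 24) by ring.
    have -> : 4 * 10 ^+ 6 * lambda ^+ 24 * y ^+ 24 = 4 * 10 ^+ 6 * lambda ^+ 23 * (lambda * y ^+ 24).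
      by ring.
    apply: ler_wpM2r; first by rewrite mulr_ge0 ?exprn_ge0 // ltW.
    by apply: le_trans hy2 _; apply: le_expr.
  apply: le_trans h3; rewrite -[leRHS]mulrA; case: regime => _ _ _ n_lt; move: n_lt nu0; move: (lambda ^+ 24 * _) => w.
  move: (nu) => v; lra.
have q0 : 0 < 1 + q by move: q99; lra.
by rewrite -[_^-1]mul1r ler_pdivrMr //; move: q99; lra.
Qed.

(** Chebyshev with deviation n^2/100: the variance is n y^56 up to lambda and powers of m, while n^4
    >= n y^72; a single factor y is retained. *)
Lemma few_close_pairs :
  200 * (784 * lambda ^+ 2 * m.+1%:R ^+ 2) <= y -> 4 * 10 ^+ 6 * lambda ^+ 23 <= y ->
  Ex (fun E => (close_pairs R L E <= 52 / 100 * nu ^+ 2)%R%:R) <=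
  10 ^+ 4 * 16 * 24 ^+ 4 * 28 ^+ 9 * lambda ^+ 3 * m.+1%:R ^+ 9 / y.
Proof.
move=> hy1 hy2; have EN := expect_close_pairs_ge hy1 hy2.
have t0 : 0 < nu ^+ 2 / 100 by rewrite divr_gt0 // exprn_gt0.
apply: (@le_trans _ _ (Ex (fun E => (close_pairs R L E <= Ex (close_pairs R L) - nu ^+ 2 / 100)%R%:R))).
  apply: le_expect => // E; case: (lerP (close_pairs R L E) (52 / 100 * nu ^+ 2)) => h /=; last exact: ler0n.
  have -> // : close_pairs R L E <= Ex (close_pairs R L) - nu ^+ 2 / 100.
  by move: EN h; move: (close_pairs R L E) (Ex _) (nu ^+ 2) => u v w; lra.
apply: le_trans (chebyshev p0 p1 _ t0) _.
rewrite ler_pdivrMr ?exprn_gt0 //; apply: le_trans (variance_close_pairs p0 p1 L lam2) _.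
rewrite npE -/nu; have LM : L%:R <= 28 * m.+1%:R :> R.
  rewrite -natrM ler_nat /L /a; clear; lia.
have lL : lambda ^+ L ^+ 2 = lambda ^+ 2 * y ^+ 56.
  by rewrite /L (exprS lambda (2 * a)) /a mulnA lamX exprMn -exprM.
rewrite lL.
have LM9 : L%:R ^+ 9 <= (28 * m.+1%:R) ^+ 9 :> R by rewrite lerXn2r ?nnegrE ?mulr_ge0.
case: (regime) => _ _ n_ge _.
have y57 : y ^+ 56 * y <= nu ^+ 3.
  rewrite -exprSr; apply: (@le_trans _ _ (y ^+ 24 ^+ 3)).
    by rewrite -exprM ler_weXn2l.
  by apply: lerXn2r; rewrite ?nnegrE ?exprn_ge0 // ltW.
have -> : 10 ^+ 4 * 16 * 24 ^+ 4 * 28 ^+ 9 * lambda ^+ 3 * m.+1%:R ^+ 9 / y * (nu ^+ 2 / 100) ^+ 2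
  = (16 * 24 ^+ 4 * lambda ^+ 3) * nu * (((28 * m.+1%:R) ^+ 9) * (nu ^+ 3 / y)).
  by field; rewrite gt_eqF.
have -> : nu * lambda * (16 * 24 ^+ 4 * L%:R ^+ 9 * (lambda ^+ 2 * y ^+ 56)) =
  (16 * 24 ^+ 4 * lambda ^+ 3) * nu * (L%:R ^+ 9 * y ^+ 56) by ring.
apply: ler_wpM2l; first by rewrite !mulr_ge0 ?exprn_ge0 // ltW.
apply: ler_pM; [by rewrite exprn_ge0 | by rewrite exprn_ge0 // ltW | exact: LM9 |].
by rewrite ler_pdivlMr.
Qed.

(** Markov: the expected number is n y^44 up to lambda and powers of m, while n^3 >= n y^48; again
    one factor y is retained. *)
Lemma many_bad_triples :
  Ex (fun E => (nu ^+ 3 / 100 <= \sum_x \sum_x' \sum_z (bad_triple E K x x' z)%:R)%R%:R) <=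
  100 * 9 * 24 ^+ 4 * 45 ^+ 8 * lambda * m.+1%:R ^+ 8 / y.
Proof.
have t0 : 0 < nu ^+ 3 / 100 by rewrite divr_gt0 // exprn_gt0.
apply: le_trans (markov p0 p1 _ t0) _.
  by move=> E; apply: sumr_ge0 => x _; apply: sumr_ge0 => x' _; apply: sumr_ge0.
rewrite ler_pdivrMr //; apply: le_trans (expect_bad_triples p0 p1 K lam2) _.
rewrite npE -/nu; have KM : K.+1%:R <= 45 * m.+1%:R :> R.
  rewrite -natrM ler_nat /K; clear; lia.
have -> : lambda ^+ K = lambda * y ^+ 44 by rewrite /K exprS lamX.
have KM8 : K.+1%:R ^+ 8 <= (45 * m.+1%:R) ^+ 8 :> R by rewrite lerXn2r ?nnegrE ?mulr_ge0.
case: (regime) => _ _ n_ge _.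
have y45 : y ^+ 44 * y <= nu ^+ 2.
  rewrite -exprSr; apply: (@le_trans _ _ (y ^+ 24 ^+ 2)).
    by rewrite -exprM ler_weXn2l.
  by apply: lerXn2r; rewrite ?nnegrE ?exprn_ge0 // ltW.
have -> : 100 * 9 * 24 ^+ 4 * 45 ^+ 8 * lambda * m.+1%:R ^+ 8 / y * (nu ^+ 3 / 100)
  = (9 * 24 ^+ 4 * lambda) * nu * (((45 * m.+1%:R) ^+ 8) * (nu ^+ 2 / y)).
  by field; rewrite gt_eqF.
have -> : nu * (K.+1%:R ^+ 3 * (lambda * y ^+ 44 * (9 * 24 ^+ 4 * K.+1%:R ^+ 5))) =
  (9 * 24 ^+ 4 * lambda) * nu * (K.+1%:R ^+ 8 * y ^+ 44) by ring.
apply: ler_wpM2l; first by rewrite !mulr_ge0 ?exprn_ge0 // ltW.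
apply: ler_pM; [by rewrite exprn_ge0 | by rewrite exprn_ge0 // ltW | exact: KM8 |].
by rewrite ler_pdivlMr.
Qed.

(** Outside the two exceptional events, good triples have proportion at least 52/100 - 1/2 - 1/100 =
    1/100, and each has [slim] and [minsize] at least [m./2]. *)
Lemma ER_prob_fat_ge (theta : R) : theta <= m./2%:R / 100 ->
  200 * (784 * lambda ^+ 2 * m.+1%:R ^+ 2) <= y -> 4 * 10 ^+ 6 * lambda ^+ 23 <= y ->
  1 - 10 ^+ 4 * 16 * 24 ^+ 4 * 28 ^+ 9 * lambda ^+ 3 * m.+1%:R ^+ 9 / y
    - 100 * 9 * 24 ^+ 4 * 45 ^+ 8 * lambda * m.+1%:R ^+ 8 / y <=
  ER_prob p (fun E : {set {set 'I_n}} =>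
    [forall C : {set 'I_n}, is_largest_component (adj E) C ==>
       (theta <= mean_slim R (induced_subgraph (adj E) C)) &&
       (theta <= mean_minsize R (induced_subgraph (adj E) C))]) <= 1.
Proof.
move=> htheta hy1 hy2; rewrite ER_probE; apply/andP; split; last first.
  rewrite -[leRHS](expect_cst p (enum (vertex_pairs n))); apply: le_expect => // E.
  by case: [forall _, _].
have h1 := few_close_pairs hy1 hy2; have h2 := many_bad_triples.
set F := fun E => ([forall C, _] : bool)%:R.
suff h : Ex (fun=> 1) <= Ex (fun E => F E +
    ((close_pairs R L E <= 52 / 100 * nu ^+ 2)%R%:R +
     (nu ^+ 3 / 100 <= \sum_x \sum_x' \sum_z (bad_triple E K x x' z)%:R)%R%:R)).
  rewrite !expectD expect_cst in h; move: h h1 h2.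
  move: (Ex _) (Ex _) (Ex _) (_ / y) (_ / y) => *; lra.
apply: le_expect => // E; rewrite /F.
set P := [forall _, _]; have [hP|nP] := boolP P; first by rewrite /= lerDl addr_ge0.
rewrite /= add0r.
case: (lerP (close_pairs R L E) (52 / 100 * nu ^+ 2)) => /= hN; first by rewrite lerDl.
rewrite add0r; case: (lerP (nu ^+ 3 / 100)) => //= hB.
case/negP: nP; apply/forallP => C; apply/implyP => hC.
have LK : (3 * L + 4 * m <= 2 * K + 1)%N by rewrite /L /K /a; clear; lia.
have g0 : 0 <= 1 / 100 :> R by rewrite divr_ge0.
have := mean_ge hC nu0 g0 LK; rewrite -/nu => /(_ _)/wrap[].
  have : nu * (52 / 100 * nu ^+ 2) <= nu * close_pairs R L E.
    by rewrite ler_wpM2l // ltW.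
  move: hB; move: (\sum_(_ < _) _) (close_pairs _ _ _) (nu) => B N v; lra.
rewrite div1r => -[h3 h4].
by rewrite (le_trans htheta h3) (le_trans htheta h4).
Qed.

End Sparse.

(* Choice of the scale and passage to the limit *)
From mathcomp Require Import all_classical all_reals all_analysis.
Import numFieldNormedType.Exports.
Local Open Scope ring_scope.

(** With q the quotient of m by j + 1, the left side is at most N (q + 1)^j <= (q + 1)^(j + 1) <=
    2^(q (j + 1)), as soon as q >= N. *)
Lemma poly_le_exp2 (R : archiRealFieldType) (c : R) (j : nat) :
  exists M, forall m, (M <= m)%N -> c * m.+1%:R ^+ j <= 2 ^+ m.
Proof.
pose N := Num.bound `|c * j.+1%:R ^+ j|.
have hN : c * j.+1%:R ^+ j <= N%:R.
  exact: le_trans (ler_norm _) (ltW (archi_boundP (normr_ge0 _))).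
exists (N * j.+1)%N => m hm; pose q := (m %/ j.+1)%N.
have Nq : (N <= q)%N by rewrite leq_divRL.
have mq : (m.+1 <= j.+1 * q.+1)%N by rewrite mulnC ltn_ceil.
apply: (@le_trans _ _ (N%:R * q.+1%:R ^+ j)).
  have [c0|c0] := ltrP c 0.
    apply: (@le_trans _ _ 0); last by rewrite mulr_ge0 ?exprn_ge0.
    by rewrite nmulr_rle0 // exprn_ge0.
  apply: (@le_trans _ _ (c * j.+1%:R ^+ j * q.+1%:R ^+ j)).
    by rewrite -mulrA ler_wpM2l // -exprMn -natrM lerXn2r ?nnegrE // ler_nat.
  by rewrite ler_wpM2r // exprn_ge0.
rewrite -natrX -natrM -natrX ler_nat.
apply: (@leq_trans (q.+1 ^ j.+1)); first by rewrite expnS leq_mul2r ltnW ?orbT.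
apply: (@leq_trans ((2 ^ q) ^ j.+1)); first by rewrite leq_exp2r // ltn_expl.
by rewrite -expnM leq_exp2l // leq_trunc_div.
Qed.

(** m is the integral part of log n / log b; the base will be lambda^24. *)
Lemma exp_bracket (R : archiRealFieldType) (b : R) (n : nat) : 2 <= b -> (0 < n)%N ->
  exists m, b ^+ m <= n%:R < b ^+ m.+1.
Proof.
move=> b2 n0; pose P k := b ^+ k <= n%:R.
have exP : exists k, P k by exists 0%N; rewrite /P expr0 ler1n.
have ubP k : P k -> (k <= n)%N.
  move=> Pk; apply: ltnW; apply: (leq_trans (ltn_expl k (isT : (1 < 2)%N))).
  rewrite -(ler_nat R) natrX; apply: le_trans Pk.
  by rewrite lerXn2r ?nnegrE // (le_trans _ b2).
case: (ex_maxnP exP ubP) => m Pm maxm; exists m; rewrite -/(P m) Pm /= ltNge.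
by apply/negP => /maxm; rewrite ltnn.
Qed.

Local Open Scope classical_set_scope.

Theorem theorem5p12 (R : realType) (lambda : R)
    (hlambda : 467%:R / 100%:R <= lambda) :
  exists f : R, 0 < f /\
    (fun n : nat =>
       ER_prob (lambda / n%:R) (fun E : {set {set 'I_n}} =>
         [forall C : {set 'I_n}, is_largest_component (adj E) C ==>
            (f * ln n%:R <= mean_slim R (induced_subgraph (adj E) C)) &&
            (f * ln n%:R <= mean_minsize R (induced_subgraph (adj E) C))]))
      @ \oo --> (1 : R).
Proof.
have l2 : 2 <= lambda by lra.
have l1 : 1 < lambda by lra.
have l0 : 0 < lambda by lra.
have lnl : 0 < ln lambda by rewrite ln_gt0.
(* From log n <= 24 (m + 1) log lambda and m + 1 <= 4 [m./2] for m >= 3, this f gives f log n <=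
   [m./2] / 100. *)
pose f := (24 * 400 * ln lambda)^-1.
have c0 : 0 < 24 * 400 :> R by rewrite -natrM ltr0n.
have d0 : 0 < 24 * 400 * ln lambda by exact: mulr_gt0.
have f0 : 0 < f by rewrite /f invr_gt0.
exists f; split; first exact: f0.
apply/cvgrPdist_le => eps eps0.
(* [A1] and [A2] are the coefficients of the two error terms, each to be made at most eps / 2. *)
pose A1 := 10 ^+ 4 * 16 * 24 ^+ 4 * 28 ^+ 9 * lambda ^+ 3 : R.
pose A2 := 100 * 9 * 24 ^+ 4 * 45 ^+ 8 * lambda : R.
have [M1 hM1] := poly_le_exp2 (A1 * (2 / eps)) 9.
have [M2 hM2] := poly_le_exp2 (A2 * (2 / eps)) 8.
have [M3 hM3] := poly_le_exp2 (200 * (784 * lambda ^+ 2)) 2.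
have [M4 hM4] := poly_le_exp2 (4 * 10 ^+ 6 * lambda ^+ 23) 0.
pose M := (maxn 3 (maxn (maxn M1 M2) (maxn M3 M4))).
(* Beyond this threshold the scale m of n is at least [M]. *)
exists (Num.bound (lambda ^+ (24 * M))) => // n /= hn.
have nM : lambda ^+ (24 * M) < n%:R.
  apply: (lt_le_trans (archi_boundP _)); first by rewrite exprn_ge0 // ltW.
  by rewrite ler_nat.
have n0 : (0 < n)%N by rewrite -(ltr0n R); apply: lt_trans nM; rewrite exprn_gt0.
have b2 : 2 <= lambda ^+ 24.
  by apply: le_trans l2 _; rewrite -{1}[lambda]expr1 ler_weXn2l // ltW.
have [m /andP[mn nm]] := exp_bracket b2 n0.
have Mm : (M <= m)%N.
  rewrite leqNgt; apply/negP => mM; have := lt_trans nM nm.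
  rewrite -exprM ltr_eXn2l // ltn_mul2l /= ltnS => hh; move: (leq_trans mM hh).
  by rewrite ltnn.
have [m3 [m1' [m2' [m3' m4']]]] : (3 <= m)%N /\ (M1 <= m)%N /\ (M2 <= m)%N /\ (M3 <= m)%N /\ (M4 <= m)%N.
  by move: Mm; rewrite /M !geq_max => /and3P[-> /andP[-> ->] /andP[-> ->]].
have y2 : 2 ^+ m <= lambda ^+ m by rewrite lerXn2r ?nnegrE // ltW.
have y0 : 0 < lambda ^+ m by rewrite exprn_gt0.
have regime : [/\ 467%:R / 100%:R <= lambda, lambda <= n%:R,
    lambda ^+ m ^+ 24 <= n%:R & n%:R < lambda ^+ 24 * lambda ^+ m ^+ 24].
  split=> //.
  - apply: ltW; apply: le_lt_trans nM; rewrite -{1}[lambda]expr1 ler_weXn2l ?(ltW l1) //.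
    by rewrite muln_gt0 /M leq_max.
  - by rewrite exprAC.
  - by rewrite exprAC -exprS.
have theta : f * ln n%:R <= m./2%:R / 100.
  have lnn : ln n%:R <= (24 * m.+1)%:R * ln lambda.
    rewrite mulr_natl -lnXn // ler_ln ?posrE ?ltr0n ?exprn_gt0 //.
    by rewrite exprM ltW.
  have m4 : (m.+1 <= 4 * m./2)%N by have := odd_double_half m; clear -m3; lia.
  rewrite /f mulrC ler_pdivrMr //.
  apply: le_trans lnn _.
  rewrite natrM mulrCA mulrA; apply: ler_wpM2r; first exact: ltW.
  have : m.+1%:R <= 4 * m./2%:R :> R by rewrite -natrM ler_nat.
  lra.
have h1 : 200 * (784 * lambda ^+ 2 * m.+1%:R ^+ 2) <= lambda ^+ m.
  by apply: le_trans y2; rewrite mulrA; exact: hM3.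
have h2 : 4 * 10 ^+ 6 * lambda ^+ 23 <= lambda ^+ m.
  by apply: le_trans y2; rewrite -[leLHS]mulr1; exact: hM4.
have /andP[lo hi] := ER_prob_fat_ge regime theta h1 h2.
rewrite ger0_norm ?subr_ge0 // lerBlDr -lerBlDl; apply: le_trans lo.
have err (A : R) j : A * (2 / eps) * m.+1%:R ^+ j <= lambda ^+ m ->
    A * m.+1%:R ^+ j / lambda ^+ m <= eps / 2.
  move=> h; rewrite ler_pdivrMr //; rewrite -ler_pdivrMl ?divr_gt0 // invf_div.
  by rewrite mulrC mulrAC.
have e1 := err A1 9 (le_trans (hM1 m m1') y2).
have e2 := err A2 8 (le_trans (hM2 m m2') y2).
rewrite -/A1 -/A2; lra.
Qed.
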